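(* Let $(P,\preccurlyeq)$ be a finite poset with $|P|>1$ whose Hasse diagram $H(P)$ is connected. Then the piping complex of $P$ is (isomorphic to) the boundary complex of the polar of the acyclonestohedron obtained as the intersection of the graph associahedron $\mathrm{Nest}(\mathcal{B}(P),\rho)$ of the line graph $L(P)$ of $H(P)$, where $\rho_T=|\mathcal{B}(P)|^{|T|}$ for all $T\in\mathcal{B}(P)$, with the linear hyperplanes normal to $\mathbf{1}_{c_+}-\mathbf{1}_{c_-}$ for all circuits $c=(c_+,c_-)$ of $H(P)$.
   Context: A pipe of $P$ is a subset $Q\subseteq P$ with $|Q|>1$ which induces a connected subgraph of $H(P)$ and is order convex ($p\preccurlyeq q\preccurlyeq r$ and $p,r\in Q$ imply $q\in Q$). Let $\mathcal{D}(P)$ be the directed graph with a vertex for each pipe and an arc from $Q$ to $R$ if $Q\cap R=\varnothing$ and there are $q\in Q$, $r\in R$ with $q\prec r$. A piping of $P$ is a set of pairwise nested or disjoint pipes of $P$ which contains the pipe $P$ and induces an acyclic subgraph of $\mathcal{D}(P)$. The piping complex of $P$ is the simplicial complex whose faces are $\mathcal{Q}\setminus\{P\}$ for all pipings $\mathcal{Q}$ of $P$. Let $S$ be the set of arcs of $H(P)$, i.e. cover relations $p\prec q$ regarded as arcs from $p$ to $q$. The circuits $c=(c_+,c_-)$ of $H(P)$ are the simple cycles of the undirected graph underlying $H(P)$, traversed in either direction, with $c_+\subseteq S$ the arcs traversed forward and $c_-\subseteq S$ those traversed backward. The line graph $L(P)$ is the graph on $S$ joining two arcs sharing an endpoint,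 and $\mathcal{B}(P)$ is the set of all non-empty subsets of $S$ inducing a connected subgraph of $L(P)$. $\mathrm{Nest}(\mathcal{B}(P),\rho)=\sum_{T\in\mathcal{B}(P)}\rho_T\triangle_T\subset\mathbb{R}^S$ (Minkowski sum), where $\triangle_T=\mathrm{conv}\{e_t:t\in T\}$ and $(e_s)_{s\in S}$ is the standard basis. $\mathbf{1}_X\in\mathbb{R}^S$ is the characteristic vector of $X\subseteq S$. The boundary complex of the polar of a polytope is, as a poset, the set of its non-empty faces ordered by reverse inclusion (the polytope itself corresponding to the empty face). *)

(* Defs.v *)
From HB Require Import structures.
From mathcomp Require Import all_boot all_order all_algebra.
From mathcomp Require Import all_classical reals convex.

Set Implicit Arguments.
Unset Strict Implicit.
Unset Printing Implicit Defensive.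

Import Order.TTheory GRing.Theory Num.Theory.

Local Open Scope ring_scope.

Definition induces_connected (T : finType) (e : rel T) (A : {set T}) : bool :=
  [forall x in A, forall y in A,
     connect [rel u v | [&& u \in A, v \in A & e u v]] x y].

Section HasseDiagram.
Context {d : Order.disp_t} (P : finPOrderType d).
Implicit Types (p q : P) (Q R : {set P}) (QQ : {set {set P}}).

Definition covers p q : bool :=
  (p < q)%O && [forall r, ~~ ((p < r)%O && (r < q)%O)].

Definition hasse_adj : rel P := [rel p q | covers p q || covers q p].

Definition hasse_arc : Type := {a : P * P | covers a.1 a.2}.

Definition arc_source (a : hasse_arc) : P := (val a).1.
Definition arc_target (a : hasse_arc) : P := (val a).2.

Definition order_convex Q : bool :=
  [forall p in Q, forall r in Q, forall q,
     ((p <= q)%O && (q <= r)%O) ==> (q \in Q)].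

Definition pipe Q : bool :=
  [&& (1 < #|Q|)%N, induces_connected hasse_adj Q & order_convex Q].

Definition pipe_arc : rel {set P} :=
  [rel Q R | [&& pipe Q, pipe R, [disjoint Q & R] &
     [exists q in Q, exists r in R, (q < r)%O]]].

Definition acyclic (T : finType) (e : rel T) (A : {set T}) : Prop :=
  forall c : seq T, all (mem A) c -> cycle e c -> c = [::].

Definition piping QQ : Prop :=
  [/\ {in QQ, forall Q, pipe Q},
      {in QQ &, forall Q R, [|| Q \subset R, R \subset Q | [disjoint Q & R]]},
      [set: P] \in QQ &
      acyclic pipe_arc QQ].

Definition piping_complex : set {set {set P}} :=
  [set N | exists2 QQ, piping QQ & N = (QQ :\ [set: P])%SET]%classic.

(* A Hasse diagram has no parallel edges, so a simple cycle of its underlying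
   graph, together with a direction, is a cyclic sequence of at least three
   distinct, consecutively adjacent vertices. *)
Definition simple_cycle (c : seq P) : bool :=
  (2 < size c)%N && ucycleb hasse_adj c.

Definition forward_arcs (c : seq P) : {set hasse_arc} :=
  [set a | (arc_source a \in c) && (next c (arc_source a) == arc_target a)].

Definition backward_arcs (c : seq P) : {set hasse_arc} :=
  [set a | (arc_target a \in c) && (next c (arc_target a) == arc_source a)].

Definition circuit (c : {set hasse_arc} * {set hasse_arc}) : Prop :=
  exists2 s, simple_cycle s & c = (forward_arcs s, backward_arcs s).

Definition line_graph : rel hasse_arc :=
  [rel a b | (a != b) &&
     ~~ [disjoint [set arc_source a; arc_target a]
                & [set arc_source b; arc_target b]]].

Definition tubes : {set {set hasse_arc}} :=
  [set T | (T != finset.set0) && induces_connected line_graph T].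

End HasseDiagram.

Arguments piping_complex {d} P.

Section Polytopes.
Context {R : realType} {S : finType}.

(* R^o rather than R, so that the space carries its R-module structure. *)
Local Notation V := {ffun S -> R^o}.

Definition dot (u x : V) : R := \sum_(s : S) (u s : R) * x s.

Definition basis_vector (s : S) : V := [ffun t => (t == s)%:R].

Definition indicator (X : {set S}) : V := [ffun t => (t \in X)%:R].

Definition convex_hull (X : set V) : set V :=
  smallest (fun A : set V => convex_set (A : set (convex_lmodType V))) X.

Definition simplex (T : {set S}) : set V :=
  convex_hull [set basis_vector t | t in [set` T]]%classic.

(* The Minkowski sum of the dilated simplices, i.e. the set of all sums of one
   point from each of them. *)
Definition nestohedron (B : {set {set S}}) (rho : {set S} -> R) : set V :=
  [set x | exists2 y : {set S} -> V,
     (forall T, T \in B -> simplex T (y T)) &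
     x = \sum_(T in B) rho T *: y T]%classic.

Definition nonempty_face (A F : set V) : Prop :=
  F !=set0%classic /\
  exists u : V, F = [set x | A x /\ forall y, A y -> dot u y <= dot u x]%classic.

End Polytopes.

Section Acyclonestohedron.
Context {d : Order.disp_t} (R : realType) (P : finPOrderType d).

Definition rho (T : {set hasse_arc P}) : R := (#|tubes P| ^ #|T|)%N%:R.

Definition acyclonestohedron : set {ffun hasse_arc P -> R^o} :=
  [set x | nestohedron (tubes P) rho x /\
     forall c, circuit c -> dot (indicator c.1 - indicator c.2) x = 0]%classic.

End Acyclonestohedron.

Arguments acyclonestohedron {d} R P.

(* K, a set of faces ordered by inclusion, is isomorphic to the boundary complex
   of the polar of A, whose faces are the non-empty faces of A ordered by
   reverse inclusion. *)
Definition isomorphic_to_polar_boundary (R : realType) (S T : finType)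
    (K : set {set T}) (A : set {ffun S -> R^o}) : Prop :=
  exists phi : {set T} -> set {ffun S -> R^o},
    set_bij K (nonempty_face A) phi /\
    forall N N', K N -> K N' -> (N \subset N' <-> (phi N' `<=` phi N)%classic).

(* Main.v *)
Require Import Defs.
From mathcomp Require Import all_classical reals interval_inference convex.
From mathcomp Require Import all_boot all_order all_algebra.
From mathcomp Require Import lra zify.

Set Implicit Arguments.
Unset Strict Implicit.
Unset Printing Implicit Defensive.

Import Order.TTheory GRing.Theory Num.Theory.

Local Open Scope ring_scope.

(** Write z(X) for the total weight of the tubes inside a set X of arcs, and
    x(X) for the sum of the coordinates of x over X. Two descriptions turn the
    acyclonestohedron into a combinatorial object. A transportation argument
    shows that the nestohedron is the set of all x with x(S) = z(S) and
    x(X) >= z(X) for every X ([nestohedronP]), and it is enough to ask for the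
    inequality on tubes ([inner_weight_le_mass]). Orthogonality to all circuits
    says that the coordinates of x are the increments of a height function on P
    ([circuits_increment]). So a point is a height function, and what matters is
    which tubes are tight, that is, satisfy x(T) = z(T).

    From points to pipings. Since z is supermodular, two tight tubes are nested
    or do not touch. Since rho grows fast, an arc that touches a tight tube T
    from outside rises by more than z(T), whereas two vertices of T differ in
    height by at most x(T) = z(T) ([tight_gap], [tight_spread]). Hence T
    consists of all arcs inside an order convex set of vertices, a pipe, and
    the least height on a pipe increases along the arcs between tight pipes, so
    that the tight pipes form a piping ([tight_pipes_piping]).

    From pipings to points. Heights on a pipe Q of a piping are built from
    heights on the maximal smaller pipes. These pipes and the remaining
    elements of Q are the blocks of Q; acyclicity of the piping makes the
    relation induced by the order on the blocks acyclic ([preceq_acyclic]), so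
    that the blocks have integer levels increasing along arcs. Adding a large
    multiple of the level to the heights inside the blocks, with the multiple
    chosen to make Q tight, keeps the smaller pipes tight. Every other tube
    inside Q must stay strictly above its bound: if it contains all arcs between
    blocks this is strict supermodularity, and otherwise it has fewer arcs than
    Q, so that its bound is smaller by about the factor #|tubes P| for each arc
    missing between the blocks. The levels are chosen in a balanced way, no arc
    taking more than half of the total rise, so that the rest of the arcs has
    enough ([level_heights], [level_sum_ge], [realizes_step]).

    Faces. A face is determined by the tubes tight at a point of it with as few
    tight tubes as possible ([nonempty_face_tight]), and these come from a
    piping; conversely the points constructed for two pipings tell the
    corresponding faces apart ([tight_face_reverse]). *)

(** * Nestohedra as solution sets of inequalities *)

Section Nestohedra.
Context {R : realType} {S : finType}.
Implicit Types (x y : S -> R) (X Y T : {set S}) (B : {set {set S}}).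
Implicit Types (z rho : {set S} -> R).

Definition mass x X : R := \sum_(s in X) x s.

(** The lower bound that a Minkowski sum of simplices with weights rho imposes on
    the coordinates in X: a simplex of a set inside X puts all its mass there. *)
Definition inner_weight B rho X : R := \sum_(T in B) rho T *+ (T \subset X).

Definition supermodular z : Prop :=
  forall X Y, z X + z Y <= z (X :|: Y) + z (X :&: Y).

Lemma mass0 x : mass x set0 = 0.
Proof. by rewrite /mass big_set0. Qed.

Lemma mass1 x s : mass x [set s] = x s.
Proof. by rewrite /mass big_set1. Qed.

Lemma mass_setID x X Y : mass x X = mass x (X :&: Y) + mass x (X :\: Y).
Proof. exact: big_setID. Qed.

Lemma mass_setUI x X Y :
  mass x (X :|: Y) + mass x (X :&: Y) = mass x X + mass x Y.
Proof.
rewrite (mass_setID x (X :|: Y) Y) [_ :&: Y]setIC setKU setDUl setDv setU0.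
by rewrite (mass_setID x X Y); lra.
Qed.

Lemma mass_ge0 x X : (forall s, s \in X -> 0 <= x s) -> 0 <= mass x X.
Proof. by move=> x0; apply: sumr_ge0. Qed.

Lemma le_mass x X Y :
  (forall s, s \in Y -> 0 <= x s) -> X \subset Y -> mass x X <= mass x Y.
Proof.
move=> x0 XY; rewrite (mass_setID x Y X) (finset.setIidPr XY) lerDl.
by apply: mass_ge0 => s /setDP[/x0].
Qed.

Lemma inner_weight0 B rho : set0 \notin B -> inner_weight B rho set0 = 0.
Proof.
move=> B0; apply: big1 => T TB; rewrite subset0.
by case: eqP => // T0; rewrite T0 (negPf B0) in TB.
Qed.

Lemma inner_weight_ge0 B rho X :
  (forall T, T \in B -> 0 <= rho T) -> 0 <= inner_weight B rho X.
Proof. by move=> r0; apply: sumr_ge0 => T TB; rewrite mulrn_wge0 ?r0. Qed.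

Lemma le_inner_weight B rho X Y :
  (forall T, T \in B -> 0 <= rho T) -> X \subset Y ->
  inner_weight B rho X <= inner_weight B rho Y.
Proof.
move=> r0 XY; apply: ler_sum => T TB; apply: ler_wpMn2l; first exact: r0.
by case: (boolP (T \subset X)) => // /subset_trans ->.
Qed.

Lemma inner_weight_gain B rho X Y T :
  (forall T, T \in B -> 0 <= rho T) ->
  T \in B -> X \subset Y -> T \subset Y -> ~~ (T \subset X) ->
  inner_weight B rho X + rho T <= inner_weight B rho Y.
Proof.
move=> r0 TB XY TY /negPf TX; rewrite /inner_weight !(big_setD1 T TB) /= TX TY.
rewrite mulr0n add0r mulr1n [leRHS]addrC lerD2r.
by apply: le_inner_weight XY => U /setD1P[_ /r0].
Qed.

Lemma inner_weight_supermodular B rho :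
  (forall T, T \in B -> 0 <= rho T) -> supermodular (inner_weight B rho).
Proof.
move=> r0 X Y; rewrite -!big_split; apply: ler_sum => T TB /=.
rewrite -!mulrnDr; apply: ler_wpMn2l; first exact: r0.
rewrite subsetI; case TX: (T \subset X); case TY: (T \subset Y) => //=.
- by rewrite (fintype.subset_trans TX (subsetUl _ _)).
- by rewrite (fintype.subset_trans TX (subsetUl _ _)).
- by rewrite (fintype.subset_trans TY (subsetUr _ _)).
Qed.

(** A set counted by the union but by neither part gives the gain; strictness
    makes tight tubes laminar. *)
Lemma inner_weight_supermodular_strict B rho X Y T :
  (forall T, T \in B -> 0 <= rho T) ->
  T \in B -> T \subset X :|: Y -> ~~ (T \subset X) -> ~~ (T \subset Y) ->
  inner_weight B rho X + inner_weight B rho Y + rho T <=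
  inner_weight B rho (X :|: Y) + inner_weight B rho (X :&: Y).
Proof.
move=> r0 TB TU /negPf TX /negPf TY.
have E Z : inner_weight B rho Z =
    inner_weight (B :\ T) rho Z + rho T *+ (T \subset Z).
  by rewrite /inner_weight (big_setD1 T TB) /= addrC.
have r0' U : U \in B :\ T -> 0 <= rho U by move=> /setD1P[_ /r0].
rewrite !E TU TX TY subsetI TX /= !addr0 mulr1n.
by have := inner_weight_supermodular r0' X Y; lra.
Qed.

(** One simplex of weight r can be subtracted from x without violating the
    bounds z given by the other ones. To spread r over T0, give as much as
    possible to T0 minus a point s1 and the rest to s1. What limits the first
    share is a set X1 containing T0 minus s1 that becomes tight, and then
    supermodularity, applied to X1 and a set containing s1, shows that the rest
    may go to s1. *)
Lemma split_off z T0 r x :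
  supermodular z -> 0 <= r -> T0 != set0 ->
  (forall X, z X + r *+ (T0 \subset X) <= mass x X) ->
  exists y, [/\ forall s, 0 <= y s, forall s, s \notin T0 -> y s = 0,
    \sum_s y s = r & forall X, z X + mass y X <= mass x X].
Proof.
move: {2}#|T0| (erefl #|T0|) => n.
elim: n => [|n IHn] in z T0 r *.
  by move/eqP; rewrite cards_eq0 => -> .
move=> cT0 zsm r0 /set0Pn[s1 s1T] xz.
pose pt c s : R := c *+ (s == s1).
have mass_pt c X : mass (pt c) X = c *+ (s1 \in X).
  rewrite /mass; case: (boolP (s1 \in X)) => sX.
    rewrite (big_setD1 s1 sX) /= /pt eqxx big1 ?addr0 // => s.
    by rewrite !inE => /andP[/negPf-> _].
  by rewrite big1 // => s sX'; rewrite /pt; case: eqP sX sX' => // -> /negPf->.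
have sum_pt c : \sum_s pt c s = c.
  by rewrite (bigD1 s1) //= /pt eqxx big1 ?addr0 // => s /negPf->.
have [T1_0|T1_0] := eqVneq (T0 :\ s1) set0.
  have T0E : T0 = [set s1] by rewrite -(setD1K s1T) T1_0 setU0.
  exists (pt r); split=> [s|s|//|X].
  - by rewrite mulrn_wge0.
  - by rewrite T0E inE /pt => /negPf->.
  - by have := xz X; rewrite T0E sub1set mass_pt.
set T1 := T0 :\ s1 in T1_0 *.
have s1T1 : s1 \notin T1 by rewrite !inE eqxx.
pose gap X := mass x X - z X.
pose PX X := (T1 \subset X) && (s1 \notin X).
have PT1 : PX T1 by rewrite /PX subxx.
case: (@arg_minP _ _ _ T1 PX gap PT1) => X1 /andP[TX1 sX1] X1min.
have gap0 X : 0 <= gap X.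
  by rewrite subr_ge0; apply: le_trans (xz X); rewrite lerDl mulrn_wge0.
(* eps is the share of T0 minus s1: adding it keeps all bounds, X1 being the
   tightest of the sets concerned. *)
pose eps := Num.min r (gap X1).
have eps0 : 0 <= eps by rewrite le_min r0 gap0.
have eps_r : eps <= r by rewrite ge_min lexx.
have eps_g : eps <= gap X1 by rewrite ge_min lexx orbT.
have TU X : s1 \in X -> (T1 \subset X) = (T0 \subset X).
  by move=> sX; rewrite -(setD1K s1T) subUset sub1set sX.
pose z' X := z X + (r - eps) *+ (s1 \in X).
have z'sm : supermodular z'.
  move=> X Y; have := zsm X Y; rewrite /z' !inE.
  by case: (s1 \in X); case: (s1 \in Y); rewrite /= ?mulr1n ?mulr0n; lra.
have xz' X : z' X + eps *+ (T1 \subset X) <= mass x X.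
  have := xz X; rewrite /z'; case: (boolP (s1 \in X)) => sX.
    rewrite TU //; case: (boolP (T0 \subset X)) => TX; rewrite ?mulr1n ?mulr0n ?addr0.
      by lra.
    rewrite /eps; have [_|_] := ltP r (gap X1); first by lra.
    have := zsm X X1; have := mass_setUI x X X1; have := xz (X :|: X1).
    have -> : T0 \subset X :|: X1.
      by rewrite -TU ?inE ?sX // (fintype.subset_trans TX1) ?subsetUr.
    by have := gap0 (X :&: X1); rewrite /gap mulr1n; lra.
  have -> : T0 \subset X = false.
    by apply/negP => /subsetP/(_ _ s1T); rewrite (negPf sX).
  rewrite !mulr0n !addr0 => xzX; case: (boolP (T1 \subset X)) => TX; last first.
    by rewrite mulr0n addr0.
  have /X1min : PX X by rewrite /PX TX.
  by rewrite mulr1n /gap in eps_g *; lra.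
have cT1 : #|T1| = n.
  by move: cT0; rewrite (cardsD1 s1) s1T => -[].
have [y [y0 yT ysum yz]] := IHn z' T1 eps cT1 z'sm eps0 T1_0 xz'.
exists (fun s => y s + pt (r - eps) s); split=> [s|s sT0||X].
- by rewrite addr_ge0 // mulrn_wge0 // subr_ge0.
- rewrite yT; last by rewrite inE (negPf sT0) andbF.
  by rewrite /pt; case: eqP sT0 => [->|]; rewrite ?s1T ?mulr0n ?addr0.
- by rewrite big_split /= ysum sum_pt; lra.
- have := yz X; rewrite /mass big_split /= -!/(mass _ _) mass_pt /z'; lra.
Qed.

(** Every x satisfying the bounds is a sum of masses sent by the sets of B to
    their own elements: split off the sets one by one. *)
Lemma transport B rho x :
  (forall T, T \in B -> 0 <= rho T) -> set0 \notin B ->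
  mass x setT = inner_weight B rho setT ->
  (forall X, inner_weight B rho X <= mass x X) ->
  exists y : {set S} -> S -> R,
    (forall T, T \in B -> [/\ forall s, 0 <= y T s,
       forall s, s \notin T -> y T s = 0 & \sum_s y T s = rho T]) /\
    forall s, x s = \sum_(T in B) y T s.
Proof.
move: {2}#|B| (erefl #|B|) => n.
elim: n => [|n IHn] in B x *.
  move/eqP; rewrite cards_eq0 => /eqP-> _ _.
  rewrite {1}/inner_weight big_set0 => xT xX.
  exists (fun _ _ => 0); split=> [T|s]; first by rewrite inE.
  rewrite big_set0; apply/eqP; rewrite eq_le.
  have := xX [set~ s]; have := xX [set s].
  rewrite /inner_weight !big_set0 mass1 => ->; rewrite andbT => x2.
  move: xT; rewrite (mass_setID x _ [set s]) setTI mass1 => <-.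
  by rewrite lerDl; move: x2; rewrite setTD.
move=> cB r0 B0 xT xX; have /set0Pn[T0 TB] : B != set0.
  by rewrite -cards_eq0 cB.
have E Z : inner_weight B rho Z =
    inner_weight (B :\ T0) rho Z + rho T0 *+ (T0 \subset Z).
  by rewrite /inner_weight (big_setD1 T0 TB) /= addrC.
have r0' T : T \in B :\ T0 -> 0 <= rho T by move=> /setD1P[_ /r0].
have T00 : T0 != set0 by apply: contraNneq B0 => <-.
have xX' X : inner_weight (B :\ T0) rho X + rho T0 *+ (T0 \subset X) <= mass x X.
  by rewrite -E.
have [y0 [y00 y0T y0s y0x]] :=
  split_off (inner_weight_supermodular r0') (r0 _ TB) T00 xX'.
have mB X : mass (fun s => x s - y0 s) X = mass x X - mass y0 X.
  by rewrite /mass big_split /= sumrN.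
have y0T' : mass y0 setT = rho T0.
  by rewrite -y0s; apply: eq_bigl => s; rewrite inE.
have [||||y [yB ys]] := IHn (B :\ T0) (fun s => x s - y0 s) _ r0'.
- by move: cB; rewrite (cardsD1 T0) TB => -[].
- by rewrite !inE (negPf B0) andbF.
- by rewrite mB xT E finset.subsetT y0T' mulr1n addrK.
- by move=> X; rewrite mB lerBrDr.
exists (fun T => if T == T0 then y0 else y T); split=> [T TB'|s].
  by case: eqVneq => [->//|TT0]; apply: yB; rewrite !inE TT0.
rewrite (big_setD1 T0 TB) /= eqxx; move/eqP: (ys s).
rewrite subr_eq addrC => /eqP->; congr (_ + _).
by apply: eq_bigr => T /setD1P[/negPf->].
Qed.

Local Notation V := {ffun S -> R^o}.

(** The hull being the least convex set that contains the vertices, one inclusion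
    is convexity of the right-hand side; the other is an induction on the
    support, which splits a point into one vertex and a rescaled remainder. *)
Lemma simplexP T (y : V) : T != set0 ->
  simplex T y <-> [/\ forall s, 0 <= (y s : R), forall s, s \notin T -> y s = 0 :> R
                   & \sum_s (y s : R) = 1].
Proof.
move=> T0; split.
  pose C : classical_sets.set V := fun v => [/\ forall s, 0 <= (v s : R),
    forall s, s \notin T -> v s = 0 :> R & \sum_s (v s : R) = 1].
  apply: (@smallest_sub _ _ _ C); last first.
    move=> _ [t tT <-]; split=> [s|s|].
    - by rewrite ffunE ler0n.
    - by rewrite ffunE; case: eqP => // ->; rewrite tT.
    - rewrite (bigD1 t) //= ffunE eqxx big1 ?addr0 // => s /negPf st.
      by rewrite ffunE st.
  move=> u v l /set_mem[u0 uT us] /set_mem[v0 vT vs]; apply: mem_set.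
  have E s : (conv l u v : V) s = l%:num * (u s : R) + (1 - l%:num) * (v s : R).
    by rewrite /conv /= !ffunE.
  split=> [s|s sT|].
  - by rewrite E addr_ge0 // mulr_ge0 // subr_ge0 le1.
  - by rewrite E uT // vT // !mulr0 addr0.
  - under eq_bigr do rewrite E.
    by rewrite big_split /= -!mulr_sumr us vs; lra.
move=> [y0 yT ys] A [cvA gA].
move: {2}#|[set s | (y s : R) != 0]| (leqnn #|[set s | (y s : R) != 0]|) => n.
elim: n => [|n IHn] in y y0 yT ys *.
  rewrite leqn0 cards_eq0 => /eqP y_0; move: ys; rewrite big1 => [/eqP|s _].
    by rewrite eq_sym oner_eq0.
  by apply/eqP; have := in_set0 s; rewrite -y_0 inE => /negbFE.
move=> cy.
have [s1 s1y] : exists s, (y s : R) != 0.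
  apply/existsP; apply: contraT; rewrite negb_exists => /forallP y_0.
  move: ys; rewrite big1 => [/eqP|s _]; first by rewrite eq_sym oner_eq0.
  by apply/eqP; have := y_0 s; rewrite negbK.
have s1T : s1 \in T by apply: contraNT s1y => /yT->.
have bA : A (basis_vector s1) by apply: gA; exists s1.
have ysD : (y s1 : R) + \sum_(s | s != s1) (y s : R) = 1.
  by rewrite -ys [RHS](bigD1 s1).
have rest0 : 0 <= \sum_(s | s != s1) (y s : R) by apply: sumr_ge0.
have [y1|y1] := eqVneq (y s1 : R) 1.
  suff -> : y = basis_vector s1 by [].
  apply/ffunP => s; rewrite ffunE; case: eqVneq => [->//|ss1] /=.
  move: ysD; rewrite y1 => /eqP; rewrite -subr_eq0 addrC addKr.
  rewrite psumr_eq0 => [/allP/(_ s)|t _ //].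
  by rewrite mem_index_enum ss1 /= => /(_ isT)/eqP.
have y1lt : (y s1 : R) < 1 by rewrite lt_neqAle y1; lra.
pose c : R := 1 - (y s1 : R).
have c0 : 0 < c by rewrite subr_gt0.
pose v : V := [ffun s => (if s == s1 then 0 else (y s : R) / c) : R^o].
have Av : A v.
  apply: IHn => [s|s sT||].
  - by rewrite ffunE; case: eqP => // _; rewrite divr_ge0 // ltW.
  - by rewrite ffunE; case: eqP => // _; rewrite yT // mul0r.
  - rewrite (bigD1 s1) //= ffunE eqxx add0r.
    under eq_bigr => s /negPf ss1 do rewrite ffunE ss1.
    rewrite -mulr_suml; apply: (@mulIf _ c); first by rewrite gt_eqF.
    by rewrite divfK ?gt_eqF // mul1r /c; lra.
  - rewrite -ltnS; apply: leq_trans cy.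
    apply: proper_card; apply/properP; split.
      apply/subsetP => s; rewrite !inE ffunE.
      by case: (s == s1); [rewrite eqxx | apply: contraNneq => ->; rewrite mul0r].
    by exists s1; rewrite !inE ?s1y // ffunE !eqxx.
have l01 : (0 <= (y s1 : R)) && ((y s1 : R) <= 1) by rewrite y0 ltW.
have := cvA (basis_vector s1) v (Itv01 (y0 s1) (ltW y1lt)).
move=> /(_ (mem_set bA) (mem_set Av))/set_mem; congr A; apply/ffunP => s.
rewrite /conv /= !ffunE /=; case: eqVneq => [->|ss1] /=.
  by rewrite /GRing.scale /= mulr1 mulr0 addr0.
rewrite /GRing.scale /= mulr0 add0r [_ * (_ / c)]mulrC divfK // gt_eqF //.
Qed.

(** Necessity of the inequalities is immediate from the simplices, sufficiency is
    the transportation lemma. *)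
Lemma nestohedronP B rho (x : V) :
  (forall T, T \in B -> 0 < rho T) -> set0 \notin B ->
  nestohedron B rho x <->
    mass x setT = inner_weight B rho setT /\
    forall X, inner_weight B rho X <= mass x X.
Proof.
move=> r0 B0.
have Bn0 T : T \in B -> T != set0 by move=> TB; apply: contraNneq B0 => <-.
split=> [[y yT ->]|[xT xX]].
  have mE X : mass (\sum_(T in B) rho T *: y T : V) X =
      \sum_(T in B) rho T * mass (y T) X.
    rewrite /mass; under eq_bigr => s _ do rewrite sum_ffunE.
    rewrite exchange_big /=; apply: eq_bigr => T TB; rewrite mulr_sumr.
    by apply: eq_bigr => s _; rewrite ffunE.
  split=> [|X]; rewrite mE.
    apply: eq_bigr => T TB; have /(simplexP _ (Bn0 _ TB))[_ _ ys] := yT T TB.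
    rewrite finset.subsetT mulr1n /mass.
    by under eq_bigl do rewrite inE; rewrite ys mulr1.
  apply: ler_sum => T TB; have /(simplexP _ (Bn0 _ TB))[y0 yn ys] := yT T TB.
  case: (boolP (T \subset X)) => TX; last first.
    by rewrite mulr0n mulr_ge0 ?mass_ge0 // ltW ?r0.
  rewrite mulr1n -[leLHS]mulr1 ler_pM2l ?r0 // -ys /mass (bigID (mem X)) /=.
  rewrite [X in _ + X]big1 ?addr0 // => s sX.
  by apply: yn; apply: contra sX; apply: (subsetP TX).
have r0' T : T \in B -> 0 <= rho T by move/r0/ltW.
have [y [yB ys]] := transport r0' B0 xT xX.
exists (fun T => [ffun s => (y T s / rho T) : R^o]) => [T TB|].
  apply/(simplexP _ (Bn0 _ TB)); have [y0 yn ysum] := yB T TB; split=> [s|s sT|].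
  - by rewrite ffunE divr_ge0 // r0'.
  - by rewrite ffunE yn // mul0r.
  - under eq_bigr do rewrite ffunE.
    by rewrite -mulr_suml ysum divff // gt_eqF // r0.
apply/ffunP => s; rewrite ys sum_ffunE; apply: eq_bigr => T TB.
by rewrite !ffunE /GRing.scale /= mulrC divfK // gt_eqF // r0.
Qed.

End Nestohedra.

(** * Connected sets and their weights *)

Section Connectivity.
Context {S : finType} (e : rel S).
Hypothesis e_sym : symmetric e.
Implicit Types (A T X : {set S}) (s t : S).

Definition inside A u v : bool := [&& u \in A, v \in A & e u v].
Arguments inside A u v /.

Definition connected_sets : {set {set S}} :=
  [set T | (T != set0) && induces_connected e T].

Lemma inside_sym A : connect_sym (inside A).
Proof. by apply: sym_connect_sym => u v; rewrite /= e_sym andbCA. Qed.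

Lemma connect_insideS A X s t :
  A \subset X -> connect (inside A) s t -> connect (inside X) s t.
Proof.
move=> /subsetP AX; apply: connect_sub => u v /and3P[uA vA uv].
by apply: connect1; rewrite /= !AX.
Qed.

Lemma induces_connectedP A :
  reflect {in A &, forall s t, connect (inside A) s t} (induces_connected e A).
Proof.
apply: (iffP idP) => [cA s t sA tA|cA].
  by move/forall_inP: cA => /(_ s sA)/forall_inP/(_ t tA).
by apply/forall_inP => s sA; apply/forall_inP => t tA; apply: cA.
Qed.

Lemma connected_ind A (Q : S -> Prop) s :
  induces_connected e A -> s \in A -> Q s ->
  (forall u v, u \in A -> v \in A -> e u v -> Q u -> Q v) ->
  forall t, t \in A -> Q t.
Proof.
move=> /induces_connectedP cA sA Qs step t tA.
have /connectP[p + ->] := cA s t sA tA.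
elim: p s Qs {sA tA} => //= u p IHp s Qs /andP[/and3P[sA uA su]].
by apply: IHp; apply: step su Qs.
Qed.

Lemma connected_from A s :
  s \in A -> (forall t, t \in A -> connect (inside A) s t) ->
  induces_connected e A.
Proof.
move=> sA cA; apply/induces_connectedP => t u tA uA.
by apply: (connect_trans _ (cA u uA)); rewrite inside_sym; apply: cA.
Qed.

Lemma connected_setsP T :
  reflect (T != set0 /\ induces_connected e T) (T \in connected_sets).
Proof. by rewrite inE; apply: andP. Qed.

Lemma connected_sets0 : set0 \notin connected_sets.
Proof. by rewrite inE eqxx. Qed.

Lemma connected_sets1 s : [set s] \in connected_sets.
Proof.
apply/connected_setsP; split; first by rewrite -cards_eq0 cards1.
by apply/induces_connectedP => u v /set1P-> /set1P->.
Qed.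

Lemma connected_setsU A X s t :
  A \in connected_sets -> X \in connected_sets -> s \in A -> t \in X ->
  s = t \/ e s t -> A :|: X \in connected_sets.
Proof.
move=> /connected_setsP[A0 /induces_connectedP cA].
move=> /connected_setsP[X0 /induces_connectedP cX] sA tX st.
apply/connected_setsP; split; first by apply/set0Pn; exists s; rewrite inE sA.
apply: (@connected_from _ s); first by rewrite inE sA.
have st' : connect (inside (A :|: X)) s t.
  by case: st => [->|st]; rewrite ?connect0 // connect1 //= !inE sA tX orbT.
move=> u /setUP[uA|uX]; first exact: connect_insideS (subsetUl _ _) (cA _ _ sA uA).
apply: connect_trans st' _.
exact: connect_insideS (subsetUr _ _) (cX _ _ tX uX).
Qed.

(** Otherwise T would be closed under adjacency inside A. *)
Lemma connected_sets_grow A T :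
  A \in connected_sets -> T \in connected_sets -> T \subset A -> T != A ->
  exists s, [/\ s \in A, s \notin T & s |: T \in connected_sets].
Proof.
move=> /connected_setsP[_ cA] TB TA neq.
have /connected_setsP[/set0Pn[t tT] _] := TB.
apply: contrapT => nogrow; move/eqP: neq; apply; apply/eqP.
rewrite finset.eqEsubset TA; apply/subsetP.
apply: (connected_ind cA (subsetP TA _ tT) tT) => u v uA vA uv uT.
apply: contrapT => /negP vT; apply: nogrow; exists v; split=> //.
rewrite finset.setUC; apply: (connected_setsU TB (connected_sets1 v) uT (set11 v)).
by right.
Qed.

Definition component A s : {set S} := [set t in A | connect (inside A) s t].

Lemma component_sub A s : component A s \subset A.
Proof. by apply/subsetP => t; rewrite inE => /andP[]. Qed.

Lemma mem_component A s : s \in A -> s \in component A s.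
Proof. by rewrite inE connect0 andbT. Qed.

Lemma component_connected A s : s \in A -> component A s \in connected_sets.
Proof.
move=> sA; apply/connected_setsP; split.
  by apply/set0Pn; exists s; apply: mem_component.
apply: (connected_from (mem_component sA)) => t; rewrite inE => /andP[_].
move=> /connectP[p pp ->] {t}; apply/connectP; exists p => //.
have lift t q : t \in component A s -> path (inside A) t q ->
    path (inside (component A s)) t q.
  elim: q t => //= u q IHq t tC /andP[/and3P[tA uA tu] pq].
  have uC : u \in component A s.
    move: tC; rewrite !inE uA /= => /andP[_ /connect_trans]; apply.
    by apply: connect1; rewrite /= tA uA.
  by rewrite tC uC tu IHq.
by apply: lift pp; apply: mem_component.
Qed.

Lemma sub_component A s T :
  T \in connected_sets -> T \subset A ->
  (T \subset component A s) || (T \subset A :\: component A s).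
Proof.
move=> /connected_setsP[_ cT] TA.
case: (pickP [pred t in T | t \in component A s]) => [t /andP[/= tT tC]|noC].
  apply/orP; left; apply/subsetP.
  apply: (connected_ind cT tT tC) => u v uT vT uv.
  rewrite !inE !(subsetP TA) //= => /connect_trans; apply.
  by apply: connect1; rewrite /= !(subsetP TA).
apply/orP; right; apply/subsetP => t tT; rewrite inE (subsetP TA _ tT) andbT.
by have := noC t; rewrite inE tT /= => ->.
Qed.

Section Weights.
Context {R : realType} (rho : {set S} -> R).

Local Notation z := (inner_weight connected_sets rho).

(** A connected subset of A lies inside a component or avoids it. *)
Lemma inner_weight_component A s : s \in A ->
  z A = z (component A s) + z (A :\: component A s).
Proof.
move=> sA; rewrite -big_split; apply: eq_bigr => T TB /=.
set C := component A s.
case: (boolP (T \subset A)) => TA; last first.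
  rewrite mulr0n; case: (boolP (T \subset C)) => [TC|_].
    by rewrite (fintype.subset_trans TC (component_sub _ _)) in TA.
  case: (boolP (T \subset A :\: C)) => [TC|_]; last by rewrite !mulr0n addr0.
  by rewrite (fintype.subset_trans TC (subsetDl _ _)) in TA.
have /set0Pn[t tT] : T != set0 by case/connected_setsP: TB.
have /orP[TC|TC] := sub_component s TB TA; rewrite TC.
- case: (boolP (T \subset A :\: C)) => [TD|_]; last by rewrite mulr0n addr0.
  by have := subsetP TD t tT; rewrite inE (subsetP TC t tT).
- case: (boolP (T \subset C)) => [TD|_]; last by rewrite mulr0n add0r.
  by have := subsetP TC t tT; rewrite inE (subsetP TD t tT).
Qed.

(** Both sides are additive over the components of X, so the inequalities for
    connected sets imply all the others. *)
Lemma inner_weight_le_mass A (x : S -> R) :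
  (forall T, T \in connected_sets -> T \subset A -> z T <= mass x T) ->
  forall X, X \subset A -> z X <= mass x X.
Proof.
move=> xT X; move: {2}#|X| (leqnn #|X|) => n.
elim: n X => [|n IHn] X.
  rewrite leqn0 cards_eq0 => /eqP-> _.
  by rewrite mass0 inner_weight0 // connected_sets0.
move=> cX XA; have [->|/set0Pn[s sX]] := eqVneq X set0.
  by rewrite mass0 inner_weight0 // connected_sets0.
have CX := component_sub X s.
rewrite (inner_weight_component sX) (mass_setID x X (component X s)).
rewrite (finset.setIidPr CX); apply: lerD.
  by apply: xT; [apply: component_connected | apply: fintype.subset_trans CX XA].
apply: IHn; last exact: fintype.subset_trans (subsetDl _ _) XA.
rewrite -ltnS; apply: leq_trans cX; apply: proper_card.
apply/properP; split; first exact: subsetDl.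
by exists s => //; rewrite inE mem_component.
Qed.

End Weights.

(** There is a singleton for each element and, growing one element at a time, a
    connected set of each larger size. *)
Lemma connected_sets_count :
  [set: S] \in connected_sets -> (#|S|.*2 <= #|connected_sets|.+1)%N.
Proof.
move=> ST; set n := #|S|.
have chain k : (0 < k)%N -> (k <= n)%N ->
    exists T, (T \in connected_sets) && (#|T| == k).
  elim: k => // k IHk _ kn; case: (posnP k) => [->|k0].
    have /connected_setsP[/set0Pn[s _] _] := ST.
    by exists [set s]; rewrite connected_sets1 cards1.
  have [T /andP[TB /eqP cT]] := IHk k0 (ltnW kn).
  have [||s [_ sT sTB]] := connected_sets_grow ST TB; first exact: finset.subsetT.
    by apply: contraTneq kn => TS; rewrite -cT TS cardsT -/n ltnn.
  by exists (s |: T); rewrite sTB cardsU1 sT cT /= add1n eqxx.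
pose f k := odflt set0 [pick T in connected_sets | #|T| == k].
have fP k : (0 < k)%N -> (k <= n)%N -> (f k \in connected_sets) /\ #|f k| = k.
  move=> k0 kn; rewrite /f; case: pickP => [T /andP[TB /eqP cT] //|no].
  by have [T] := chain k k0 kn; rewrite no.
(* n singletons, followed by one set of each size from 2 to n *)
pose l := [seq [set s] | s <- enum S] ++ [seq f k | k <- iota 2 n.-1].
have nE : (n.-1 < n)%N.
  have /connected_setsP[/set0Pn[s _] _] := ST.
  by rewrite ltn_predL /n -cardsT (cardD1 s) inE.
have fk k : k \in iota 2 n.-1 -> (f k \in connected_sets) /\ #|f k| = k.
  by rewrite mem_iota => /andP[k2 kn]; apply: fP; lia.
have l_uniq : uniq l.
  rewrite cat_uniq map_inj_uniq ?enum_uniq /=; last exact: finset.set1_inj.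
  apply/andP; split.
    apply/hasPn => _ /mapP[k kI ->]; apply/negP => /mapP[s _ fs].
    have [_] := fk k kI; rewrite fs cards1 => k1.
    by move: kI; rewrite -k1 mem_iota.
  rewrite map_inj_in_uniq ?iota_uniq // => j k jI kI fjk.
  by have [_ <-] := fk j jI; have [_ <-] := fk k kI; rewrite fjk.
suff /(uniq_leq_size l_uniq) : {subset l <= enum connected_sets}.
  rewrite size_cat !size_map size_iota -enumT -cardT -cardE -/n; move=> le_l.
  apply: leq_trans (_ : (n + n.-1).+1 <= _)%N; first by rewrite -addnn -addnS; lia.
  by rewrite ltnS.
move=> T; rewrite mem_cat mem_enum => /orP[] /mapP[s].
  by move=> _ ->; apply: connected_sets1.
by move=> /fk[fB _] ->.
Qed.

End Connectivity.

Lemma sum_exp_card (R : comNzRingType) (S : finType) (b : R) (X : {set S}) :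
  \sum_(T : {set S} | T \subset X) b ^+ #|T| = (1 + b) ^+ #|X|.
Proof.
have -> : (1 + b) ^+ #|X| = \prod_s ((if s \in X then b else 0) + 1).
  rewrite (bigID (mem X)) /= [X in _ * X]big1 ?mulr1 => [|s /negPf->]; last exact: add0r.
  by under eq_bigr => s -> do rewrite addrC; rewrite prodr_const.
rewrite bigA_distr big_mkcond /=; apply: eq_bigr => T _.
case: (boolP (T \subset X)) => [TX|/subsetPn[s sT sX]].
  rewrite (bigID (mem T)) /= [X in _ * X]big1 ?mulr1 => [|s /negPf-> //].
  under eq_bigr => s sT do rewrite sT (subsetP TX _ sT).
  by rewrite prodr_const.
by rewrite (bigD1 s) //= sT (negPf sX) mul0r.
Qed.

(** The bound counts all non-empty subsets of X; the empty set accounts for the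
    difference 1. *)
Lemma inner_weight_exp (R : realType) (S : finType) (B : {set {set S}}) b X :
  set0 \notin B ->
  inner_weight B (fun T => (b ^ #|T|)%N%:R) X <= ((1 + b) ^ #|X|)%N%:R - 1 :> R.
Proof.
move=> B0; rewrite natrX natrD -sum_exp_card (bigD1 set0) ?sub0set //=.
rewrite cards0 expr0 [leRHS]addrC addrA addNr add0r.
rewrite /inner_weight big_mkcond [leRHS]big_mkcond /=; apply: ler_sum => T _.
case: (boolP (T \in B)) => [TB|_]; last by case: ifP => //; rewrite exprn_ge0 ?ler0n.
have -> : T != set0 by apply: contraTneq TB => ->.
by rewrite andbT natrX; case: (T \subset X).
Qed.

(** In the form (1 + 1/b)^k <= b/(b - k): the bound z(T) < (1 + b)^#|T| loses
    only a small factor against b^#|T|. *)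
Lemma expn_succ_bound k b :
  (k <= b)%N -> ((b - k) * (1 + b) ^ k <= b ^ k.+1)%N.
Proof.
elim: k => [|k IHk] kb; first by rewrite subn0 muln1 expn1.
apply: leq_trans (_ : b * ((b - k) * (1 + b) ^ k) <= _)%N.
  by rewrite expnS !mulnA leq_mul2r; apply/orP; right; nia.
by rewrite [(b ^ k.+2)%N]expnS leq_mul2l IHk ?orbT // ltnW.
Qed.

(** * Arcs, tubes and pipes of a Hasse diagram *)

Section HasseArcs.
Context {d : Order.disp_t} {P : finPOrderType d}.
Local Notation arc := (hasse_arc P).
Local Notation line := (@line_graph d P).
Implicit Types (a b : arc) (p q r v : P) (Q : {set P}) (T X : {set arc}).

Definition ends a : {set P} := [set arc_source a; arc_target a].

Definition arcs_in Q : {set arc} :=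
  [set a | (arc_source a \in Q) && (arc_target a \in Q)].

Definition vertices T : {set P} := \bigcup_(a in T) ends a.

Lemma arc_lt a : (arc_source a < arc_target a)%O.
Proof. by have /andP[] := valP a. Qed.

Lemma coversP p q :
  reflect (exists a, arc_source a = p /\ arc_target a = q) (covers p q).
Proof.
apply: (iffP idP) => [pq|[a [<- <-]]]; last exact: (valP a).
by exists (exist _ (p, q) pq).
Qed.

Lemma arc_inj a b :
  arc_source a = arc_source b -> arc_target a = arc_target b -> a = b.
Proof.
move=> s t; apply: val_inj; move: s t; rewrite /arc_source /arc_target.
by case: (val a) (val b) => ? ? [? ?] /= -> ->.
Qed.

Lemma mem_source a : arc_source a \in ends a.
Proof. by rewrite !inE eqxx. Qed.

Lemma mem_target a : arc_target a \in ends a.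
Proof. by rewrite !inE eqxx orbT. Qed.

Lemma endsP a v :
  reflect (v = arc_source a \/ v = arc_target a) (v \in ends a).
Proof. by rewrite !inE; apply: (iffP orP) => -[/eqP|/eqP]; auto. Qed.

Lemma arcs_inE Q a : (a \in arcs_in Q) = (ends a \subset Q).
Proof. by rewrite !inE subUset !sub1set. Qed.

Lemma arcs_in_sub Q Q' : Q \subset Q' -> arcs_in Q \subset arcs_in Q'.
Proof.
by move=> QQ'; apply/subsetP => a; rewrite !arcs_inE => /fintype.subset_trans; apply.
Qed.

Lemma verticesP T v :
  reflect (exists2 a, a \in T & v \in ends a) (v \in vertices T).
Proof. by apply: (iffP bigcupP) => -[a]; exists a. Qed.

Lemma sub_arcs_in_vertices T : T \subset arcs_in (vertices T).
Proof.
apply/subsetP => a aT; rewrite arcs_inE; apply/subsetP => v va.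
by apply/verticesP; exists a.
Qed.

Lemma vertices_arcs_in Q : vertices (arcs_in Q) \subset Q.
Proof. by apply/subsetP => v /verticesP[a]; rewrite arcs_inE => /subsetP; apply. Qed.

Lemma vertices_sub T X : T \subset X -> vertices T \subset vertices X.
Proof.
by move=> /subsetP TX; apply/subsetP => v /verticesP[a /TX aX va]; apply/verticesP; exists a.
Qed.

Lemma hasse_adjP p q :
  reflect (exists a, (arc_source a = p /\ arc_target a = q) \/
                     (arc_source a = q /\ arc_target a = p)) (hasse_adj p q).
Proof.
apply: (iffP orP) => [[/coversP[a]|/coversP[a]]|[a [aE|aE]]].
- by exists a; left.
- by exists a; right.
- by left; apply/coversP; exists a.
- by right; apply/coversP; exists a.
Qed.

Lemma line_sym : symmetric line.
Proof. by move=> a b; rewrite /line_graph /= eq_sym disjoint_sym. Qed.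

Lemma line_graph_meet a b v :
  v \in ends a -> v \in ends b -> a = b \/ line a b.
Proof.
move=> va vb; case: (eqVneq a b) => [|ab]; [by left | right].
by rewrite /line_graph /= ab; apply/pred0Pn; exists v; rewrite /= va.
Qed.

Lemma line_graph_common a b : line a b -> exists2 v, v \in ends a & v \in ends b.
Proof. by move=> /andP[_ /pred0Pn[v /andP[va vb]]]; exists v. Qed.

Lemma tubesU T X v : T \in tubes P -> X \in tubes P ->
  v \in vertices T -> v \in vertices X -> T :|: X \in tubes P.
Proof.
move=> TB XB /verticesP[a aT va] /verticesP[b bX vb].
exact: (connected_setsU line_sym TB XB aT bX (line_graph_meet va vb)).
Qed.

Lemma tubesU1 T a v : T \in tubes P -> v \in vertices T -> v \in ends a ->
  a |: T \in tubes P.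
Proof.
move=> TB vT va; apply: (@tubesU _ _ v) => //; first exact: connected_sets1.
by apply/verticesP; exists a; rewrite ?set11.
Qed.

(** An element strictly inside the interval splits it into two smaller ones, one of
    which still leaves Q; an interval with nothing inside is an arc. *)
Lemma exit_arc Q p q : p \in Q -> q \notin Q -> (p <= q)%O ->
  exists a, [/\ arc_source a \in Q, arc_target a \notin Q,
    (p <= arc_source a)%O & (arc_target a <= q)%O].
Proof.
move: {2}_.+1 (ltnSn #|[set r | (p < r < q)%O]|) => n.
elim: n => // n IHn in p q *; rewrite ltnS => cn pQ qQ le_pq.
have {le_pq}pq : (p < q)%O.
  by rewrite lt_neqAle le_pq andbT; apply: contraNneq qQ => <-.
case: (pickP (fun r => (p < r < q)%O)) => [r /andP[pr rq]|no]; last first.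
  have /coversP[a [aE bE]] : covers p q.
    by rewrite /covers pq; apply/forallP => r; rewrite no.
  by exists a; rewrite aE bE; split.
have lt_card (B : {set P}) : B \subset [set r | (p < r < q)%O] -> r \notin B -> (#|B| < n)%N.
  move=> BI rB; apply: leq_trans cn; apply: proper_card.
  by apply/properP; split=> //; exists r; rewrite ?inE ?pr.
case: (boolP (r \in Q)) => rQ.
  have [|a [aQ bQ ra bq]] := IHn r q _ rQ qQ (ltW rq).
    apply: lt_card; last by rewrite inE ltxx.
    by apply/subsetP => s; rewrite !inE => /andP[/(lt_trans pr)-> ->].
  by exists a; split=> //; apply: le_trans (ltW pr) ra.
have [|a [aQ bQ ra bq]] := IHn p r _ pQ rQ (ltW pr).
  apply: lt_card; last by rewrite inE ltxx andbF.
  by apply/subsetP => s; rewrite !inE => /andP[-> /lt_trans->].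
by exists a; split=> //; apply: le_trans bq (ltW rq).
Qed.

Lemma entry_arc Q p q : p \notin Q -> q \in Q -> (p <= q)%O ->
  exists a, [/\ arc_source a \notin Q, arc_target a \in Q,
    (p <= arc_source a)%O & (arc_target a <= q)%O].
Proof.
move=> pQ qQ pq; have [||a] := @exit_arc (~: Q) p q _ _ pq; rewrite ?inE ?negbK //.
by move=> [sQ tQ ? ?]; exists a; split=> //; rewrite inE in sQ.
Qed.

(** An element without arcs would be a connected component of Q. *)
Lemma connected_incident Q v :
  (1 < #|Q|)%N -> induces_connected (@hasse_adj d P) Q -> v \in Q ->
  exists2 a, a \in arcs_in Q & v \in ends a.
Proof.
move=> cQ conQ vQ; apply: contrapT => no_arc.
suff QE : Q = [set v] by rewrite QE cards1 in cQ.
apply/eqP; rewrite finset.eqEsubset sub1set vQ andbT; apply/subsetP => u uQ.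
apply/set1P; move: u uQ; apply: (connected_ind conQ vQ erefl) => u w uQ wQ uw uv.
case: no_arc; rewrite -{}uv in vQ *; have /hasse_adjP[a aE] := uw; exists a.
  by rewrite inE; case: aE => -[-> ->]; rewrite uQ wQ.
by apply/endsP; case: aE => -[-> ->]; auto.
Qed.

(** So a pipe can be recovered from its arcs, and pipes may be treated as tubes. *)
Lemma arcs_in_connected Q :
  (1 < #|Q|)%N -> induces_connected (@hasse_adj d P) Q ->
  arcs_in Q \in tubes P /\ vertices (arcs_in Q) = Q.
Proof.
move=> cQ conQ; have inc := connected_incident cQ conQ.
have [v0 v0Q] : exists v, v \in Q by apply/card_gt0P; apply: ltnW.
have [a0 a0Q v0a] := inc v0 v0Q.
split; last first.
  apply/eqP; rewrite finset.eqEsubset vertices_arcs_in; apply/subsetP => v vQ.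
  by apply/verticesP; have [a] := inc v vQ; exists a.
apply/connected_setsP; split; first by apply/set0Pn; exists a0.
apply: (connected_from line_sym a0Q) => a aQ.
have meet b c v : b \in arcs_in Q -> c \in arcs_in Q -> v \in ends b ->
    v \in ends c -> connect (inside line (arcs_in Q)) b c.
  move=> bQ cQ' vb vc; have [->|bc] := line_graph_meet vb vc; first exact: connect0.
  by apply: connect1; rewrite /inside bQ cQ' bc.
suff reach v : v \in Q -> forall b, b \in arcs_in Q -> v \in ends b ->
    connect (inside line (arcs_in Q)) a0 b.
  apply: (reach (arc_source a)) => //; last exact: mem_source.
  by move: aQ; rewrite inE => /andP[].
move: v; apply: (connected_ind conQ v0Q) => [b bQ vb|u v uQ vQ uv IHu b bQ vb].
  exact: meet a0Q bQ v0a vb.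
have /hasse_adjP[c cE] := uv.
have cQ' : c \in arcs_in Q by rewrite inE; case: cE => -[-> ->]; rewrite uQ vQ.
have [uc vc] : u \in ends c /\ v \in ends c.
  by case: cE => -[<- <-]; rewrite ?mem_source ?mem_target.
exact: connect_trans (IHu c cQ' uc) (meet _ _ v cQ' bQ vc vb).
Qed.

Lemma pipe_tube Q : pipe Q -> arcs_in Q \in tubes P.
Proof. by case/and3P => cQ /(arcs_in_connected cQ)[]. Qed.

Lemma pipe_vertices Q : pipe Q -> vertices (arcs_in Q) = Q.
Proof. by case/and3P => cQ /(arcs_in_connected cQ)[]. Qed.

(** Adjacency of vertices through the arcs of T alone. *)
Definition joined T u v : bool :=
  [exists a in T, ((arc_source a == u) && (arc_target a == v)) ||
                  ((arc_source a == v) && (arc_target a == u))].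

Lemma joinedP T u v :
  reflect (exists2 a, a \in T &
    (arc_source a = u /\ arc_target a = v) \/ (arc_source a = v /\ arc_target a = u))
    (joined T u v).
Proof.
apply: (iffP exists_inP) => -[a aT].
  by case/orP => /andP[/eqP<- /eqP<-]; exists a; auto.
by case=> -[<- <-]; exists a => //; rewrite !eqxx ?orbT.
Qed.

Lemma tube_joined T p q : T \in tubes P -> p \in vertices T -> q \in vertices T ->
  connect (joined T) p q.
Proof.
move=> /connected_setsP[_ conT] /verticesP[a aT pa] /verticesP[b bT qb].
have across c u v : c \in T -> u \in ends c -> v \in ends c ->
    connect (joined T) u v.
  move=> cT /endsP[]-> /endsP[]->; rewrite ?connect0 //; apply: connect1.
    by apply/joinedP; exists c; auto.
  by apply/joinedP; exists c; auto.
move: b bT q qb; apply: (connected_ind conT aT) => [q|b c bT cT bc IHb q qc].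
  exact: across.
have [v vb vc] := line_graph_common bc.
exact: connect_trans (IHb v vb) (across c v q cT vc qc).
Qed.

Lemma tube_vertices T : T \in tubes P ->
  (1 < #|vertices T|)%N /\ induces_connected (@hasse_adj d P) (vertices T).
Proof.
move=> TB; have /connected_setsP[/set0Pn[a aT] _] := TB; split.
  apply: leq_trans (subset_leq_card (_ : ends a \subset _)).
    by rewrite /ends cards2 (lt_eqF (arc_lt a)).
  by apply/subsetP => v va; apply/verticesP; exists a.
apply/induces_connectedP => u v uT vT.
apply: connect_sub (tube_joined TB uT vT) => p q /joinedP[b bT bE].
apply: connect1; rewrite /inside; apply/and3P; split.
- by apply/verticesP; exists b => //; apply/endsP; case: bE => -[-> ->]; auto.
- by apply/verticesP; exists b => //; apply/endsP; case: bE => -[-> ->]; auto.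
- by apply/hasse_adjP; exists b.
Qed.

Section Increments.
Context {R : realType}.
Implicit Types h : P -> R.

Definition increment h a : R := h (arc_target a) - h (arc_source a).

(** A simple path uses each arc at most once, so the total increment along it
    is at most the sum of all increments. *)
Lemma spread_le_mass h T p q : (forall a, a \in T -> 0 <= increment h a) ->
  connect (joined T) p q -> h q - h p <= mass (increment h) T.
Proof.
move=> h0 /connectP[s0 /shortenP[s ps us _] ->] {q}.
pose C := [set a in T | (arc_source a \in p :: s) && (arc_target a \in p :: s)].
apply: le_trans (_ : mass (increment h) C <= _); last first.
  by apply: le_mass => //; apply/subsetP => a; rewrite inE => /andP[].
rewrite {}/C; elim: s p ps us => [|q s IHs] p /=.
  by rewrite subrr => _ _; apply: mass_ge0 => a; rewrite inE => /andP[/h0].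
move=> /andP[/joinedP[a aT aE] qs] /andP[ps us].
have := IHs q qs us; set C := [set _ in T | _]; set D := [set _ in T | _] => le_C.
have aD : a \in D by rewrite !inE aT; case: aE => -[-> ->]; rewrite !eqxx ?orbT.
have aC : a \notin C.
  by rewrite !inE; case: aE => -[-> ->]; rewrite -!in_cons (negPf ps) ?andbF.
have CD : a |: C \subset D.
  apply/subsetP => b /setU1P[->//|]; rewrite !inE.
  by case/and3P => -> /orP[]-> /orP[]->; rewrite ?orbT.
have h0D b : b \in D -> 0 <= increment h b by rewrite inE => /andP[/h0].
apply: le_trans (le_mass h0D CD); rewrite /mass big_setU1 //= -/(mass _ C).
have : h q - h p <= increment h a.
  case: aE => -[aE bE]; rewrite /increment -aE -bE //.
  by have := h0 a aT; rewrite /increment aE bE; lra.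
by lra.
Qed.

End Increments.
End HasseArcs.

(** * Circuits and potentials *)

Section Potentials.
Context {d : Order.disp_t} {P : finPOrderType d} {R : realType}.
Local Notation arc := (hasse_arc P).
Local Notation adj := (@hasse_adj d P).
Implicit Types (x : arc -> R) (u v : P) (s : seq P) (h : P -> R).

(** The value of x along a step of a walk, with the sign of the direction in which
    the arc is traversed; it is 0 if there is no arc between u and v. *)
Definition step_weight x u v : R :=
  \sum_(a | (arc_source a == u) && (arc_target a == v)) x a -
  \sum_(a | (arc_source a == v) && (arc_target a == u)) x a.

Fixpoint walk_weight x u s : R :=
  if s is v :: s' then step_weight x u v + walk_weight x v s' else 0.

Lemma step_weightN x u v : step_weight x v u = - step_weight x u v.
Proof. by rewrite /step_weight opprB. Qed.

Lemma step_weight_arc x (a : arc) :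
  step_weight x (arc_source a) (arc_target a) = x a.
Proof.
rewrite /step_weight (big_pred1 a) => [|b]; last first.
  apply/andP/eqP => [[/eqP s /eqP t]|->]; [exact: arc_inj | by rewrite !eqxx].
rewrite big1 ?subr0 // => b /andP[/eqP s /eqP t].
by have := arc_lt b; rewrite s t => /(lt_trans (arc_lt a)); rewrite ltxx.
Qed.

Lemma step_weight_increment h u v :
  adj u v -> step_weight (increment h) u v = h v - h u.
Proof.
move=> /hasse_adjP[a [] [<- <-]]; first by rewrite step_weight_arc.
by rewrite step_weightN step_weight_arc opprB.
Qed.

Lemma walk_weight_cat x u s t :
  walk_weight x u (s ++ t) = walk_weight x u s + walk_weight x (last u s) t.
Proof. by elim: s u => [|v s IHs] u /=; rewrite ?add0r // IHs addrA. Qed.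

Lemma walk_weight_increment h u s :
  path adj u s -> walk_weight (increment h) u s = h (last u s) - h u.
Proof.
elim: s u => [|v s IHs] u /=; first by rewrite subrr.
by move=> /andP[uv /IHs->]; rewrite step_weight_increment //; lra.
Qed.

Lemma walk_weight_nth x u s :
  walk_weight x u s = \sum_(i < size s) step_weight x (nth u (u :: s) i) (nth u s i).
Proof.
elim: s u => [|v s IHs] u /=; first by rewrite big_ord0.
rewrite big_ord_recl /= IHs; congr (_ + _); apply: eq_bigr => i _.
by rewrite (set_nth_default u v) /= ?(set_nth_default u v (ltn_ord i)) // ltnW ?ltnS.
Qed.

Lemma walk_weight_cycle x u s : uniq (u :: s) ->
  walk_weight x u (rcons s u) =
  \sum_(v <- u :: s) step_weight x v (next (u :: s) v).
Proof.
move=> us; rewrite walk_weight_nth size_rcons (big_nth u) big_mkord.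
apply: eq_bigr => i _.
have -> : nth u (u :: rcons s u) i = nth u (u :: s) i.
  by rewrite -rcons_cons nth_rcons /= ltn_ord.
rewrite next_nth mem_nth ?index_uniq //; congr step_weight.
rewrite nth_rcons; case: ltnP => // si; rewrite nth_default //.
by case: eqP.
Qed.

Lemma dot_circuit (x : {ffun arc -> R^o}) s : uniq s ->
  dot (indicator (forward_arcs s) - indicator (backward_arcs s)) x =
  \sum_(v <- s) step_weight x v (next s v).
Proof.
move=> us; rewrite big_uniq //= sumrB.
have -> : dot (indicator (forward_arcs s) - indicator (backward_arcs s)) x =
    \sum_(a in forward_arcs s) (x a : R) - \sum_(a in backward_arcs s) (x a : R).
  rewrite /dot [X in _ = X - _]big_mkcond [X in _ = _ - X]big_mkcond -sumrB.
  apply: eq_bigr => a _; rewrite !ffunE.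
  by case: (a \in _); case: (a \in _); rewrite /= ?mulr1n ?mulr0n; lra.
congr (_ - _).
  rewrite (partition_big (@arc_source d P) (mem s)) /=; last first.
    by move=> a; rewrite inE => /andP[].
  apply: eq_bigr => v vs; apply: eq_bigl => a; rewrite inE.
  case: (eqVneq (arc_source a) v) => [->|]; last by rewrite andbF.
  by rewrite vs andbT eq_sym.
rewrite (partition_big (@arc_target d P) (mem s)) /=; last first.
  by move=> a; rewrite inE => /andP[].
apply: eq_bigr => v vs; apply: eq_bigl => a; rewrite inE.
case: (eqVneq (arc_target a) v) => [->|]; last by rewrite !andbF.
by rewrite vs !andbT eq_sym.
Qed.

Lemma not_uniq_split s : ~~ uniq s ->
  exists v s1 s2 s3, s = s1 ++ v :: s2 ++ v :: s3.
Proof.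
elim: s => //= v s IHs; rewrite negb_and negbK => /orP[|/IHs].
  by case/splitPr => s1 s2; exists v, [::], s1, s2.
by move=> [u [s1 [s2 [s3 ->]]]]; exists u, (v :: s1), s2, s3.
Qed.

(** A closed walk that repeats a vertex splits there into two shorter ones; one
    that does not is a simple cycle or goes back and forth along one arc. *)
Lemma closed_walk_weight (x : {ffun arc -> R^o}) :
  (forall c, circuit c -> dot (indicator c.1 - indicator c.2) x = 0) ->
  forall u s, path adj u s -> last u s = u -> walk_weight x u s = 0.
Proof.
move=> xc u s; move: {2}_.+1 (ltnSn (size s)) => n.
elim: n => // n IHn in u s *; rewrite ltnS => sn us su.
case: (boolP (uniq s)) => [s_uniq|/not_uniq_split[v [s1 [s2 [s3 sE]]]]]; last first.
  move: us su sn; rewrite {}sE cat_path /= cat_path last_cat /= last_cat /=.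
  move=> /and3P[us1 s1v /and3P[vs2 s2v vs3]] s3u.
  rewrite !size_cat /= size_cat /= => sn.
  have loop : walk_weight x v (rcons s2 v) = 0.
    apply: IHn; rewrite ?last_rcons // ?rcons_path ?vs2 // size_rcons.
    by apply: leq_trans sn; lia.
  have rest : walk_weight x u (s1 ++ v :: s3) = 0.
    apply: IHn; rewrite ?last_cat //= ?cat_path /= ?us1 ?s1v // size_cat /=.
    by apply: leq_trans sn; lia.
  move: loop rest; rewrite -cats1 !walk_weight_cat /= walk_weight_cat /=; lra.
case: s / (lastP s) sn us su s_uniq => [//|s w].
rewrite last_rcons => sn us wu; move: sn us; rewrite {w}wu => sn us s_uniq.
have us_uniq : uniq (u :: s) by rewrite /= -rcons_uniq.
case: s => [|v [|w s]] in sn us s_uniq us_uniq *.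
- by move: us; rewrite /= andbT /hasse_adj /= /covers ltxx.
- by rewrite /= step_weightN; lra.
rewrite walk_weight_cycle // -dot_circuit //.
apply: (xc (forward_arcs _, backward_arcs _)); exists [:: u, v, w & s] => //.
by rewrite /simple_cycle /= /ucycleb us_uniq andbT.
Qed.

(** The height of a vertex is the weight of any walk to it from a fixed root: it
    does not depend on the walk as closed walks have weight 0. Conversely the
    weight of an increment telescopes along a cycle. *)
Lemma circuits_increment (x : {ffun arc -> R^o}) :
  induces_connected adj [set: P] -> (0 < #|P|)%N ->
  (forall c, circuit c -> dot (indicator c.1 - indicator c.2) x = 0) <->
  exists h, forall a, x a = increment h a.
Proof.
move=> /induces_connectedP conP; rewrite -cardsT => /card_gt0P[r _]; split; last first.
  move=> [h xh] _ [s /andP[_ /andP[cs us]] ->] /=; rewrite dot_circuit //.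
  case: s cs us => [|u s] cs us; first by rewrite big_nil.
  have -> : \sum_(v <- u :: s) step_weight x v (next (u :: s) v) =
      walk_weight x u (rcons s u) by rewrite walk_weight_cycle.
  have -> : walk_weight x u (rcons s u) = walk_weight (increment h) u (rcons s u).
    rewrite !walk_weight_nth; apply: eq_bigr => i _.
    by rewrite /step_weight; congr (_ - _); apply: eq_bigr => a _; apply: xh.
  by rewrite walk_weight_increment // last_rcons subrr.
(* The same walk t back from v to r closes a walk through u and one through v;
   comparing them gives the increment along the arc. *)
move=> xc; have walk u v : exists s, path adj u s /\ last u s = v.
  have /connectP[s us ->] := conP u v (in_setT _) (in_setT _); exists s; split=> //.
  by apply: sub_path us => p q /and3P[].
have /choice[s sP] := walk r.
exists (fun v => walk_weight x r (s v)) => a.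
set u := arc_source a; set v := arc_target a.
have [su lu] := sP u; have [sv lv] := sP v; have [t [vt tr]] := walk v r.
have uv : adj u v by apply/hasse_adjP; exists a; left.
have W1 : walk_weight x r (s u ++ v :: t) = 0.
  by apply: closed_walk_weight => //; rewrite ?cat_path ?last_cat /= ?su ?lu ?uv.
have W2 : walk_weight x r (s v ++ t) = 0.
  by apply: closed_walk_weight => //; rewrite ?cat_path ?last_cat /= ?sv ?lv.
move: W1 W2; rewrite !walk_weight_cat /= lu lv step_weight_arc /increment -/u -/v.
by move=> W1 W2; apply/eqP; rewrite -subr_eq0; apply/eqP; lra.
Qed.

End Potentials.

(** * Tight tubes of a point form a piping *)

Section TightPipes.
Context {d : Order.disp_t} {P : finPOrderType d} (R : realType).
Local Notation arc := (hasse_arc P).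
Local Notation b := #|tubes P|.
Local Notation z := (inner_weight (tubes P) (@rho d R P)).
Hypotheses (cardP : (1 < #|P|)%N)
  (connP : induces_connected (@hasse_adj d P) [set: P]).
Implicit Types (a : arc) (T X : {set arc}) (Q : {set P}) (p q r v : P).

Lemma arcs_in_setT : arcs_in [set: P] = [set: arc].
Proof. by apply/setP => a; rewrite !inE. Qed.

Lemma full_tube : [set: arc] \in tubes P.
Proof.
rewrite -arcs_in_setT; have [] // := @arcs_in_connected _ _ [set: P] _ connP.
by rewrite cardsT.
Qed.

Lemma pipe_setT : pipe [set: P].
Proof.
rewrite /pipe cardsT cardP connP /=.
by apply/forall_inP => p _; apply/forall_inP => r _; apply/forallP => q; rewrite inE implybT.
Qed.

Lemma tubes_count : (#|{: arc}|.*2 <= b.+1)%N.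
Proof. exact: connected_sets_count line_sym full_tube. Qed.

Lemma arcs_gt0 : (0 < #|{: arc}|)%N.
Proof.
have /connected_setsP[/set0Pn[a _] _] := full_tube.
by rewrite -cardsT; apply/card_gt0P; exists a; rewrite inE.
Qed.

Lemma tubes_ge_arcs : (#|{: arc}| <= b)%N.
Proof. by have := tubes_count; have := arcs_gt0; lia. Qed.

Lemma rho_gt0 T : T \in tubes P -> 0 < rho R T.
Proof.
move=> TB; rewrite ltr0n expn_gt0; apply/orP; left.
by apply: leq_trans tubes_ge_arcs; apply: arcs_gt0.
Qed.

Lemma rho_ge0 T : T \in tubes P -> 0 <= rho R T.
Proof. by move/rho_gt0/ltW. Qed.

Lemma inner_weight_lt T : z T + 1 <= ((1 + b) ^ #|T|)%N%:R.
Proof. by rewrite -lerBrDr; apply/inner_weight_exp/connected_sets0. Qed.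

(** This is what the fast growth of rho is for: the weight of one new tube exceeds
    that of all tubes inside the old one. *)
Lemma inner_weight_lt_rho T a : a \notin T -> z T < rho R (a |: T).
Proof.
move=> aT; have cT : (#|T| < b)%N.
  apply: leq_trans tubes_ge_arcs; rewrite -cardsT; apply: proper_card.
  by apply/properP; split; [apply: finset.subsetT | exists a; rewrite ?inE].
apply: (@lt_le_trans _ _ ((1 + b) ^ #|T|)%N%:R).
  by apply: lt_le_trans (inner_weight_lt T); rewrite ltrDl ltr01.
rewrite ler_nat cardsU1 aT add1n; apply: leq_trans (expn_succ_bound (ltnW cT)).
by rewrite leq_pmull // subn_gt0.
Qed.

Lemma inner_weight_tube_gt0 T : T \in tubes P -> 0 < z T.
Proof.
move=> TB; rewrite /inner_weight (big_setD1 T TB) /= subxx mulr1n.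
apply: ltr_pwDl; first exact: rho_gt0.
by apply: sumr_ge0 => X /setD1P[_ XB]; rewrite mulrn_wge0 // rho_ge0.
Qed.

Lemma inner_weightU1 T a v : T \in tubes P -> v \in vertices T -> v \in ends a ->
  a \notin T -> z T + rho R (a |: T) <= z (a |: T).
Proof.
move=> TB vT va aT; have UB := tubesU1 TB vT va.
apply: inner_weight_gain rho_ge0 UB (subsetUr _ _) (subxx _) _.
by rewrite subUset sub1set (negPf aT).
Qed.

Section TightTubes.
Context (x : arc -> R).
Hypothesis x_ge : forall X, z X <= mass x X.

Lemma feasible_gt0 a : 0 < x a.
Proof.
rewrite -(mass1 x a); apply: lt_le_trans (x_ge _).
exact/inner_weight_tube_gt0/connected_sets1.
Qed.

(** Adding a to T creates the tube a |: T, whose weight must be carried by a, as T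
    has nothing to spare. *)
Lemma tight_gap T a v : T \in tubes P -> mass x T = z T ->
  v \in vertices T -> v \in ends a -> a \notin T -> z T < x a.
Proof.
move=> TB Tt vT va aT; apply: lt_le_trans (inner_weight_lt_rho aT) _.
rewrite -(lerD2l (z T)); apply: le_trans (inner_weightU1 TB vT va aT) _.
by apply: le_trans (x_ge _) _; rewrite /mass big_setU1 //= -/(mass x T) Tt addrC.
Qed.

(** If two touching tight tubes were not nested, their union would be a tube that
    makes supermodularity strict, contradicting the bounds for the union and the
    intersection. *)
Lemma tight_laminar T X v : T \in tubes P -> X \in tubes P ->
  mass x T = z T -> mass x X = z X -> v \in vertices T -> v \in vertices X ->
  (T \subset X) || (X \subset T).
Proof.
move=> TB XB Tt Xt vT vX; apply: contraT; rewrite negb_or => /andP[TX XT].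
have UB := tubesU TB XB vT vX.
have UT : ~~ (T :|: X \subset T) by rewrite subUset subxx.
have UX : ~~ (T :|: X \subset X) by rewrite subUset subxx andbT.
have := inner_weight_supermodular_strict rho_ge0 UB (subxx _) UT UX.
move=> /le_trans/(_ (lerD (x_ge (T :|: X)) (x_ge (T :&: X)))).
by rewrite mass_setUI Tt Xt gerDl leNgt rho_gt0.
Qed.

End TightTubes.

Section TightHeights.
Context (h : P -> R).
Hypothesis h_ge : forall X, z X <= mass (increment h) X.

Definition tight_pipes : {set {set P}} :=
  [set Q | pipe Q & mass (increment h) (arcs_in Q) == z (arcs_in Q)].

(** A descent from p to q would cross an arc from heights at least h p to lower
    ones. *)
Lemma height_mono p q : (p <= q)%O -> h p <= h q.
Proof.
move=> pq; rewrite leNgt; apply/negP => qp.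
have [||a []] := @exit_arc _ _ [set r | h p <= h r] p q _ _ pq.
- by rewrite inE.
- by rewrite inE -ltNge.
rewrite !inE -ltNge => pa ap _ _.
by have := feasible_gt0 h_ge a; rewrite /increment; lra.
Qed.

Section OneTube.
Context (T : {set arc}).
Hypotheses (TB : T \in tubes P) (Tt : mass (increment h) T = z T).

Lemma tight_spread p q : p \in vertices T -> q \in vertices T -> h q - h p <= z T.
Proof.
move=> pT qT; rewrite -Tt; apply: spread_le_mass (tube_joined TB pT qT) => a _.
exact/ltW/(feasible_gt0 h_ge).
Qed.

(** The first arc that leaves T on the way up already rises by more than z T. *)
Lemma tight_exit p q : p \in vertices T -> q \notin vertices T -> (p <= q)%O ->
  z T < h q - h p.
Proof.
move=> pT qT pq; have [a [aT aT' pa aq]] := exit_arc pT qT pq.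
have := tight_gap h_ge TB Tt aT (mem_source a) _.
have -> : a \notin T.
  by apply: contra aT' => aT'; apply/verticesP; exists a => //; apply: mem_target.
move=> /(_ isT); have := height_mono pa; have := height_mono aq.
by rewrite /increment; lra.
Qed.

Lemma tight_entry p q : p \notin vertices T -> q \in vertices T -> (p <= q)%O ->
  z T < h q - h p.
Proof.
move=> pT qT pq; have [a [aT' aT pa aq]] := entry_arc pT qT pq.
have := tight_gap h_ge TB Tt aT (mem_target a) _.
have -> : a \notin T.
  by apply: contra aT' => aT'; apply/verticesP; exists a => //; apply: mem_source.
move=> /(_ isT); have := height_mono pa; have := height_mono aq.
by rewrite /increment; lra.
Qed.

(** An outside arc joining two vertices of T would rise by more than z T, a
    bound for the differences of heights on T. *)
Lemma tight_full : T = arcs_in (vertices T).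
Proof.
apply/eqP; rewrite finset.eqEsubset sub_arcs_in_vertices; apply/subsetP => a.
rewrite inE => /andP[sT tT]; apply: contraT => aT.
have := tight_gap h_ge TB Tt sT (mem_source a) aT.
by have := tight_spread sT tT; rewrite /increment; lra.
Qed.

(** Leaving T upwards rises by more than z T, so the way up never comes back. *)
Lemma tight_pipe : pipe (vertices T).
Proof.
have [cT conT] := tube_vertices TB; rewrite /pipe cT conT /=.
apply/forall_inP => p pT; apply/forall_inP => r rT; apply/forallP => q.
apply/implyP => /andP[pq qr]; apply: contraT => qT.
have := tight_exit pT qT pq; have := tight_spread pT rT; have := height_mono qr.
by lra.
Qed.

Lemma tight_tube_pipe : exists2 Q, Q \in tight_pipes & T = arcs_in Q.
Proof.
exists (vertices T); last exact: tight_full.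
by rewrite inE tight_pipe -tight_full Tt eqxx.
Qed.

End OneTube.

Lemma tight_pipesP Q :
  reflect (pipe Q /\ mass (increment h) (arcs_in Q) = z (arcs_in Q)) (Q \in tight_pipes).
Proof. by rewrite inE; apply: (iffP andP) => -[? /eqP]; split=> //; apply/eqP. Qed.

(** Entering Q' from below rises by more than the spread of heights on Q'. *)
Lemma tight_pipe_arc Q Q' :
  Q \in tight_pipes -> Q' \in tight_pipes -> pipe_arc Q Q' ->
  exists2 q, q \in Q & forall r, r \in Q' -> h q < h r.
Proof.
move=> /tight_pipesP[pQ tQ] /tight_pipesP[pQ' tQ'] /and4P[_ _ dis].
move=> /exists_inP[q qQ /exists_inP[s sQ' qs]]; exists q => // r rQ'.
have VE := pipe_vertices pQ'; have TB := pipe_tube pQ'.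
have qQ' : q \notin vertices (arcs_in Q') by rewrite VE (disjointFr dis qQ).
rewrite -VE in sQ' rQ'; have := tight_entry TB tQ' qQ' sQ' (ltW qs).
by have := tight_spread TB tQ' rQ' sQ'; lra.
Qed.

(** The least height over a pipe strictly increases along the arcs between tight
    pipes, so there is no cycle. *)
Lemma tight_pipes_acyclic : acyclic (@pipe_arc d P) tight_pipes.
Proof.
move=> c /allP cT cyc; apply: contrapT => /eqP c0.
have [Q0 Q0c] : exists Q, Q \in c by case: c c0 {cT cyc} => // Q c _; exists Q; rewrite mem_head.
have [p0 p0Q] : exists p, p \in Q0.
  have /tight_pipesP[/and3P[cQ _ _] _] := cT _ Q0c.
  by apply/card_gt0P; apply: ltnW.
have ex : [exists Q in c, p0 \in Q] by apply/exists_inP; exists Q0.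
case: (@arg_minP _ _ _ p0 (fun p => [exists Q in c, p \in Q]) h ex).
move=> p /exists_inP[Q Qc pQ] pmin.
have Q'c : prev c Q \in c by rewrite mem_prev.
have [q qQ'] := tight_pipe_arc (cT _ Q'c) (cT _ Qc) (prev_cycle cyc Qc).
move=> /(_ p pQ); rewrite ltNge => /negP; apply; apply: pmin.
by apply/exists_inP; exists (prev c Q).
Qed.

Lemma tight_pipes_piping :
  mass (increment h) setT = z setT -> piping tight_pipes.
Proof.
move=> hT; split; last exact: tight_pipes_acyclic.
- by move=> Q /tight_pipesP[].
- move=> Q Q' /tight_pipesP[pQ tQ] /tight_pipesP[pQ' tQ'].
  case: (boolP [disjoint Q & Q']) => [_|/pred0Pn[v /andP[/= vQ vQ']]].
    by rewrite !orbT.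
  rewrite orbF; move: vQ vQ'; rewrite -{1}(pipe_vertices pQ) -{1}(pipe_vertices pQ').
  move=> vQ vQ'; rewrite -(pipe_vertices pQ) -(pipe_vertices pQ').
  have /orP[/vertices_sub->//|/vertices_sub->] :=
    tight_laminar h_ge (pipe_tube pQ) (pipe_tube pQ') tQ tQ' vQ vQ'.
  by rewrite orbT.
- by apply/tight_pipesP; rewrite arcs_in_setT; split=> //; apply: pipe_setT.
Qed.

End TightHeights.
End TightPipes.

(** * Balanced heights and estimates *)

Section BalancedHeights.
Context {V A : finType} (s t : A -> V) (E : {set A}).
Implicit Types f H : V -> nat.

(** Following unit arcs downwards from v produces one arc for each height up to
    that of v. *)
Lemma grounded_height f :
  (forall v, (0 < f v)%N -> exists a, [/\ a \in E, t a = v & f v = (f (s a)).+1]) ->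
  forall v, (f v <= #|[set a in E | (f (t a) == (f (s a)).+1) & (f (t a) <= f v)%N]|)%N.
Proof.
move=> f_ground v; move: {2}(f v) (erefl (f v)) => n.
elim: n v => [|n IHn] v fv; first by rewrite fv.
have [|a [aE ta fa]] := f_ground v; first by rewrite fv.
have fs : f (s a) = n by move: fa; rewrite fv => -[].
set G := [set _ in _ | _]; rewrite fv (cardsD1 a) !inE aE ta fa eqxx leqnn add1n ltnS -fs.
apply: leq_trans (IHn _ fs) _; apply: subset_leq_card; apply/subsetP => c.
rewrite !inE => /and3P[-> /eqP fc c_le]; rewrite fc eqxx /=.
rewrite fa; move: c_le; rewrite fc => c_le; apply/andP; split; last exact: ltnW.
by apply: contraTneq c_le => ->; rewrite ltnn.
Qed.

(** Take heights of least sum. Then every vertex of positive height has an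
    incoming unit arc, since it could be lowered otherwise. So below the target
    of an arc a there are as many unit arcs as its height, which bounds this
    height by #|E|; if a is longer than 1, it is not among them and their total
    length is at least the length of a. *)
Lemma balanced_heights f :
  (forall a, a \in E -> (f (s a) < f (t a))%N) ->
  exists H, forall a, a \in E ->
    [/\ (H (s a) < H (t a))%N, (H (t a) <= #|E|)%N &
      (1 < #|E|)%N ->
      ((H (t a) - H (s a)).*2 <= \sum_(c in E) (H (t c) - H (s c)))%N].
Proof.
move: {2}_.+1 (ltnSn (\sum_v f v)%N) => n; elim: n f => // n IHn f.
rewrite ltnS => fn f_incr.
case: (pickP (fun v => (0 < f v)%N &&
    [forall (a | a \in E), (t a == v) ==> (f v != (f (s a)).+1)])).
  move=> v /andP[fv0 /forall_inP no_v].
  apply: (IHn (fun u => if u == v then (f v).-1 else f u)).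
    apply: leq_trans fn; rewrite (bigD1 v) //= [X in (_ < X)%N](bigD1 v) //= eqxx.
    rewrite (eq_bigr f) => [|u /negPf-> //]; lia.
  move=> a aE; have := f_incr a aE; have := no_v a aE.
  case: (eqVneq (t a) v) => [<-|_] /=; last by case: (eqVneq (s a) v) => [->|] ?; lia.
  by case: (eqVneq (s a) (t a)) => [->|_]; lia.
move=> no_v; have f_ground v : (0 < f v)%N ->
    exists a, [/\ a \in E, t a = v & f v = (f (s a)).+1].
  move=> fv; have := no_v v; rewrite fv /= => /negbT/forall_inPn[a aE].
  by rewrite negb_imply negbK => /andP[/eqP ta /eqP fa]; exists a.
exists f => a aE; have fa := f_incr a aE; have := grounded_height f_ground (t a).
set G := [set _ in _ | _] => fG.
have GE : G \subset E by apply/subsetP => c; rewrite inE => /andP[].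
split=> // [|E1]; first exact: leq_trans fG (subset_leq_card GE).
rewrite (big_setD1 a aE) /= -addnn leq_add2l.
have [fa1|fa1] := eqVneq (f (t a)) (f (s a)).+1.
  have /card_gt0P[c] : (0 < #|E :\ a|)%N.
    by move: E1; rewrite (cardsD1 a) aE add1n.
  move=> cE; rewrite (big_setD1 c cE) /=; have /setD1P[_ /f_incr] := cE; lia.
have Ga : G \subset E :\ a.
  apply/subsetP => c cG; rewrite in_setD1 (subsetP GE _ cG) andbT.
  by apply: contra_neq fa1 => <-; move: cG; rewrite !inE => /and3P[_ /eqP].
apply: leq_trans (leq_subr _ _) _; apply: leq_trans fG _; rewrite -sum1_card.
rewrite [leqRHS](big_setID G) /= (finset.setIidPr Ga).
apply: leq_trans (leq_addr _ _); apply: leq_sum => c cG.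
by have := f_incr c (subsetP GE _ cG); lia.
Qed.

End BalancedHeights.

(** The estimate for a tube that misses one of the l arcs between the blocks of a
    pipe with n arcs: the summands bound twice the weight inside the tube and twice
    the error due to the heights inside the blocks. *)
Lemma expn_bound_miss_one b n l : (n.*2 <= b.+1)%N -> (1 < l <= n)%N ->
  (2 * (1 + b) ^ n.-1 + 2 * l * ((1 + b) ^ (n - l)).-1 <= b ^ n)%N.
Proof.
move=> nb /andP[l1 ln]; have [nl|nl] := eqVneq n l.
  rewrite nl subnn expn0 /= muln0 addn0.
  apply: leq_trans (_ : (b - l.-1) * (1 + b) ^ l.-1 <= _)%N.
    by rewrite leq_mul2r; apply/orP; right; lia.
  by apply: leq_trans (expn_succ_bound _) _; [lia | rewrite prednK //; lia].
have [k nE] : exists k, n = k.+2 by exists n.-2; lia.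
apply: leq_trans (_ : 2 * (b + 3) * (1 + b) ^ k <= _)%N.
  have -> : n.-1 = k.+1 by rewrite nE.
  have [j lE] : exists j, l = j.+2 by exists l.-2; lia.
  have jk : (j <= k)%N by lia.
  have -> : (n - l = k - j)%N by lia.
  have jpow i : (i.+2 <= 2 * (1 + b) ^ i)%N.
    by elim: i => [|i IHi]; rewrite ?expn0 ?expnS //; nia.
  have : (l * ((1 + b) ^ (k - j)).-1 <= 2 * (1 + b) ^ k)%N.
    apply: leq_trans (_ : j.+2 * (1 + b) ^ (k - j) <= _)%N.
      by rewrite lE leq_mul2l; apply/orP; right; lia.
    by rewrite -(subnKC jk) expnD mulnA addKn leq_mul2r jpow orbT.
  by rewrite expnS; lia.
apply: leq_trans (_ : b * ((b - k) * (1 + b) ^ k) <= _)%N.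
  by rewrite mulnA leq_mul2r; apply/orP; right; nia.
by rewrite nE [(b ^ k.+2)%N]expnS leq_mul2l expn_succ_bound ?orbT //; lia.
Qed.

(** The estimate for a tube that misses at least two of these arcs; the square of l
    bounds the sum of the lengths of all l arcs. *)
Lemma expn_bound_miss_two b n l : (n.*2 <= b.+1)%N -> (2 < l <= n)%N ->
  (l ^ 2 * (1 + b) ^ n.-2 + 2 * l ^ 2 * ((1 + b) ^ (n - l)).-1 <= b ^ n)%N.
Proof.
move=> nb /andP[l1 ln]; have [k nE] : exists k, n = k.+3 by exists n.-2.-1; lia.
apply: leq_trans (_ : 2 * n ^ 2 * (1 + b) ^ k.+1 <= _)%N.
  have -> : n.-2 = k.+1 by rewrite nE.
  have : ((1 + b) ^ (n - l) <= (1 + b) ^ k)%N by rewrite leq_pexp2l //; lia.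
  have : (2 * (1 + b) ^ k <= (1 + b) ^ k.+1)%N by rewrite expnS leq_mul2r; lia.
  have : (l ^ 2 <= n ^ 2)%N by rewrite leq_exp2r.
  set u := (_ ^ k.+1)%N; set v := (_ ^ (n - l))%N; set w := (_ ^ k)%N => h1 h2 h3.
  have : (2 * v.-1 <= u)%N by lia.
  by nia.
apply: leq_trans (_ : b * ((b - k.+1) * (1 + b) ^ k.+1) <= _)%N.
  by rewrite mulnA leq_mul2r; apply/orP; right; nia.
by rewrite nE [(b ^ k.+3)%N]expnS leq_mul2l expn_succ_bound ?orbT //; lia.
Qed.

Section LevelSums.
Context {R : realType} {A : finType} (E : {set A}) (len : A -> nat).
Context (x e : A -> R) (delta zeta : R) (b n : nat).
Hypotheses (x_def : forall a, a \in E -> x a = delta * (len a)%:R + e a)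
  (e_le : forall a, a \in E -> `|e a| <= zeta)
  (len_gt0 : forall a, a \in E -> (0 < len a)%N)
  (len_le : forall a, a \in E -> (len a <= #|E|)%N)
  (len_half : forall a, a \in E -> (1 < #|E|)%N ->
     ((len a).*2 <= \sum_(c in E) len c)%N)
  (x_total : (b ^ n)%N%:R <= mass x E)
  (zeta_le : zeta + 1 <= ((1 + b) ^ (n - #|E|))%N%:R)
  (En : (#|E| <= n)%N) (nb : (n.*2 <= b.+1)%N).

(** Here n is the number of arcs of a pipe, E is the set of its arcs between
    blocks, and each x a is proportional to the length of a up to an error e a.
    If T misses a single arc of E, that arc takes at most about half of the
    total, and the rest is enough. If T misses more, the threshold is so low
    that a single arc of T reaches it, a share of at least 1/#|E|^2 of the total
    being left to each arc, up to the error. *)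
Lemma level_sum_ge (T : {set A}) : T \proper E -> T != set0 ->
  ((1 + b) ^ (n - #|E :\: T|))%N%:R <= mass x T.
Proof.
move=> /properP[TE [a0 a0E a0T]] /set0Pn[a1 a1T]; have a1E := subsetP TE _ a1T.
pose l := #|E|.
have len_l a : a \in E -> (len a <= l)%N by exact: len_le.
have zeta_l : zeta + 1 <= ((1 + b) ^ (n - l))%N%:R by exact: zeta_le.
have ln : (l <= n)%N by exact: En.
have l1 : (1 < l)%N.
  rewrite /l (cardsD1 a0) a0E (cardsD1 a1) !inE a1E andbT.
  by rewrite (memPn a0T).
have zeta0 : 0 <= zeta by apply: le_trans (e_le a0E); apply: normr_ge0.
pose L := (\sum_(c in E) len c)%N.
have Ll : (L <= l ^ 2)%N.
  by rewrite -mulnn {1}/l -sum_nat_const; apply: leq_sum => c /len_l.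
have lL : (l <= L)%N by rewrite /l -sum1_card; apply: leq_sum => c /len_gt0.
have totalE : mass x E = delta * L%:R + mass e E.
  by rewrite /L natr_sum mulr_sumr -big_split; apply: eq_bigr => c /x_def.
have e_total : `|mass e E| <= l%:R * zeta.
  apply: le_trans (ler_norm_sum _ _ _) _.
  by rewrite mulr_natl -sumr_const; apply: ler_sum => c /e_le.
have zeta_pred : zeta <= ((1 + b) ^ (n - l)).-1%:R.
  rewrite -subn1 natrB ?expn_gt0 //; lra.
have miss_one : 2 * ((1 + b) ^ n.-1)%N%:R + 2 * l%:R * zeta <= (b ^ n)%N%:R.
  have := @expn_bound_miss_one b n l nb; rewrite l1 ln => /(_ isT).
  rewrite -(ler_nat R) natrD !natrM; apply: le_trans; rewrite lerD2l.
  by rewrite ler_wpM2l // mulr_ge0 ?ler0n.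
have pow0 : 0 <= ((1 + b) ^ n.-1)%N%:R :> R by rewrite ler0n.
have L0 : 0 < L%:R :> R by rewrite ltr0n; apply: leq_trans lL; apply: ltnW.
have lz0 : 0 <= l%:R * zeta by rewrite mulr_ge0 ?ler0n.
have deltaL : (b ^ n)%N%:R - l%:R * zeta <= delta * L%:R.
  move: e_total; rewrite ler_norml => /andP[_ e_ub].
  by move: x_total; rewrite totalE; lra.
have delta0 : 0 <= delta.
  by rewrite -(pmulr_lge0 _ L0); lra.
have [m1|m1] := eqVneq #|E :\: T| 1%N.
  have /cards1P[a aE'] : #|E :\: T| == 1%N by rewrite m1.
  have aE : a \in E by have := set11 a; rewrite -aE' => /setDP[].
  have : mass x E = mass x T + x a.
    by rewrite (mass_setID x E T) (finset.setIidPr TE) aE' mass1.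
  have : 2 * x a <= mass x E + l%:R * zeta + 2 * zeta.
    have : delta * (len a).*2%:R <= delta * L%:R.
      by rewrite ler_wpM2l // ler_nat; apply: len_half.
    rewrite x_def // -muln2 natrM mulrA.
    have := e_le aE; rewrite ler_norml => /andP[? ?].
    by move: e_total; rewrite ler_norml => /andP[? ?]; lra.
  have : 2 * zeta <= l%:R * zeta by rewrite ler_wpM2r // (ler_nat R 2).
  by rewrite m1 subn1; move: x_total; lra.
have m2 : (2 <= #|E :\: T|)%N.
  rewrite ltn_neqAle eq_sym m1; apply/card_gt0P; exists a0.
  by rewrite inE a0E a0T.
have l3 : (2 < l)%N.
  rewrite /l -(cardsID T E) (finset.setIidPr TE); apply: (@leq_add 1 2) => //.
  by apply/card_gt0P; exists a1.
have miss_two : l%:R ^+ 2 * ((1 + b) ^ n.-2)%N%:R + 2 * l%:R ^+ 2 * zeta <= (b ^ n)%N%:R.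
  have := @expn_bound_miss_two b n l nb; rewrite l3 ln => /(_ isT).
  rewrite -(ler_nat R) natrD !natrM !natrX; apply: le_trans; rewrite lerD2l.
  by rewrite ler_wpM2l // mulr_ge0 ?exprn_ge0 ?ler0n // -natrX.
have x_ge c : c \in E -> ((1 + b) ^ n.-2)%N%:R <= x c.
  move=> cE; rewrite x_def //.
  have delta_ge : ((1 + b) ^ n.-2)%N%:R + zeta <= delta.
    rewrite -(ler_pM2r L0); apply: le_trans deltaL.
    have Ll' : L%:R <= l%:R ^+ 2 :> R by rewrite -natrX ler_nat.
    have lL' : l%:R <= L%:R :> R by rewrite ler_nat.
    set p := (_ ^ _)%:R in miss_two *.
    have p0 : 0 <= p by rewrite ler0n.
    have : p * L%:R <= p * l%:R ^+ 2 by rewrite ler_wpM2l.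
    have : zeta * L%:R <= zeta * l%:R ^+ 2 by rewrite ler_wpM2l.
    have : zeta * l%:R <= zeta * L%:R by rewrite ler_wpM2l.
    by lra.
  have : delta * 1 <= delta * (len c)%:R by rewrite ler_wpM2l // (ler_nat R 1) len_gt0.
  by have := e_le cE; rewrite ler_norml mulr1 => /andP[? ?]; lra.
apply: le_trans (_ : x a1 <= _).
  apply: le_trans (x_ge _ a1E); rewrite ler_nat leq_pexp2l //.
  by rewrite -subn2 leq_sub2l.
rewrite -(mass1 x a1); apply: le_mass; last by rewrite sub1set.
by move=> c /(subsetP TE)/x_ge; apply: le_trans; rewrite ler0n.
Qed.

End LevelSums.

(** * Blocks of a pipe in a piping *)

Section QuotientClasses.
Context {d : Order.disp_t} {P : finPOrderType d} (QQ : {set {set P}}).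
Hypothesis QQ_piping : piping QQ.
Context (Q : {set P}).
Hypothesis QQQ : Q \in QQ.
Implicit Types (p q u v w : P) (C : {set P}).

Definition subpipes : {set {set P}} := [set C in QQ | C \proper Q].

(** The pipes of the piping that contain v form a chain, so the union is the
    largest one strictly inside Q, if there is any. *)
Definition block v : {set P} := v |: \bigcup_(C in subpipes | v \in C) C.

(** Reachability for this relation is the order induced on the blocks of Q. *)
Definition preceq u v : bool :=
  [&& u \in Q, v \in Q & (u <= v)%O || (block u == block v)].

Lemma subpipesP C : reflect (C \in QQ /\ C \proper Q) (C \in subpipes).
Proof. by rewrite inE; apply: andP. Qed.

Lemma pipe_QQ C : C \in QQ -> pipe C.
Proof. by case: QQ_piping => + _ _ _; apply. Qed.

Lemma mem_block v : v \in block v.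
Proof. exact: setU11. Qed.

Lemma sub_block C v : C \in subpipes -> v \in C -> C \subset block v.
Proof.
move=> CD vC; apply: fintype.subset_trans (subsetUr _ _).
by apply: (bigcup_sup C); rewrite CD.
Qed.

Lemma block_cases v : block v = [set v] \/ block v \in subpipes.
Proof.
case: (pickP [pred C in subpipes | v \in C]) => [C0 /andP[/= C0D vC0]|no].
  right; pose F C := (C \in subpipes) && (v \in C).
  have FC0 : F C0 by rewrite /F C0D.
  case: (arg_maxnP (fun C : {set P} => #|C|) FC0) => C /andP[CD vC] Cmax.
  suff -> : block v = C by [].
  apply/eqP; rewrite finset.eqEsubset sub_block // andbT subUset sub1set vC.
  apply/bigcupsP => C' /andP[CD' vC'].
  have /subpipesP[CQ _] := CD; have /subpipesP[CQ' _] := CD'.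
  case: QQ_piping => _ /(_ C C' CQ CQ') + _ _ => /or3P[CC|//|dis].
    have /eqP-> // : C == C'.
    by rewrite eqEcard CC; apply: Cmax; rewrite /F CD'.
  by have := disjointFr dis vC; rewrite vC'.
left; rewrite /block big1 ?setU0 // => C /andP[CD vC].
by have := no C; rewrite inE CD vC.
Qed.

Lemma block_subpipe C v : C \in subpipes -> v \in C -> block v \in subpipes.
Proof.
move=> CD vC; case: (block_cases v) => // vE.
have /subpipesP[/pipe_QQ/and3P[C1 _ _] _] := CD.
have := subset_leq_card (sub_block CD vC); rewrite vE cards1.
by rewrite leqNgt C1.
Qed.

Lemma block_eq u v : u \in block v -> block u = block v.
Proof.
move=> uv; case: (block_cases v) => [vE|vD].
  by move: uv; rewrite vE => /set1P->.
have uD := block_subpipe vD uv; apply/eqP.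
rewrite finset.eqEsubset (sub_block vD uv) andbT.
by apply: (sub_block uD); apply: (subsetP (sub_block vD uv)); apply: mem_block.
Qed.

Lemma block_subpipe_eq C v :
  C \in subpipes -> v \in C -> forall u, u \in C -> block u = block v.
Proof. by move=> CD vC u uC; apply: block_eq; apply: (subsetP (sub_block CD vC)). Qed.

Lemma block_disjoint u v : block u != block v -> [disjoint block u & block v].
Proof.
move=> uv; apply/pred0P => w /=; apply: contraNF uv => /andP[wu wv].
by rewrite -(block_eq wu) -(block_eq wv).
Qed.

Lemma block_neq_subpipe u v :
  block u = block v -> u != v -> block u \in subpipes.
Proof.
move=> uv neq; case: (block_cases u) => // uE.
by have := mem_block v; rewrite -uv uE => /set1P vu; rewrite vu eqxx in neq.
Qed.

Lemma subpipe_sub C : C \in subpipes -> C \subset Q.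
Proof. by move=> /subpipesP[_ /proper_sub]. Qed.

(** A normal form of paths, obtained by absorbing inequalities between blocks into
    arcs between pipes. *)
Lemma preceq_path v w : connect preceq v w -> w \in Q ->
  (v <= w)%O \/
  exists p q, [/\ block p \in subpipes, block q \in subpipes,
    (v <= p)%O, (q <= w)%O & connect (inside (@pipe_arc d P) QQ) (block p) (block q)].
Proof.
move=> /connectP[s + ->].
elim/last_ind: s => [|s w' IHs]; first by left.
rewrite rcons_path last_rcons; set u := last v s in IHs *.
move=> /andP[vs /and3P[uQ w'Q uw]] _; have {}IHs := IHs vs uQ.
case/orP: uw => [uw|/eqP uw].
  case: IHs => [vu|[p [q [pD qD vp qu pq]]]]; first by left; apply: le_trans vu uw.
  by right; exists p, q; split=> //; apply: le_trans qu uw.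
have [<-//|neq] := eqVneq u w'.
have uD := block_neq_subpipe uw neq; have w'D : block w' \in subpipes by rewrite -uw.
right; case: IHs => [vu|[p [q [pD qD vp qu pq]]]].
  by exists u, w'; split=> //; rewrite -uw connect0.
exists p, w'; split=> //; apply: connect_trans pq _; rewrite -uw.
have [->|qu_neq] := eqVneq (block q) (block u); first exact: connect0.
have /subpipesP[qQ _] := qD; have /subpipesP[uQQ _] := uD.
apply: connect1; rewrite /inside qQ uQQ /= /pipe_arc /= !pipe_QQ // block_disjoint //=.
apply/exists_inP; exists q; first exact: mem_block.
apply/exists_inP; exists u; first exact: mem_block.
by rewrite lt_neqAle qu andbT; apply: contraNneq qu_neq => ->.
Qed.

(** A way back from v to u would close up either inside one block, which then
    contains u and v by convexity, or to a cycle of pipes in the piping. *)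
Lemma preceq_acyclic u v : u \in Q -> v \in Q -> (u < v)%O ->
  block u != block v -> ~~ connect preceq v u.
Proof.
move=> uQ vQ uv neq; apply/negP => /preceq_path/(_ uQ)[vu|].
  by have := lt_le_trans uv vu; rewrite ltxx.
move=> [p [q [pD qD vp qu pq]]].
have qp : (q < p)%O by apply: le_lt_trans qu (lt_le_trans uv vp).
have /subpipesP[pQ _] := pD; have /subpipesP[qQ _] := qD.
have [eq_pq|neq_pq] := eqVneq (block p) (block q).
  have /and3P[_ _ /forall_inP/(_ q)] := pipe_QQ pQ.
  rewrite eq_pq mem_block => /(_ isT)/forall_inP/(_ p).
  rewrite -eq_pq mem_block => /(_ isT)/forallP between.
  have uB : u \in block p.
    by apply: (implyP (between u)); rewrite qu (le_trans (ltW uv)).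
  have vB : v \in block p.
    by apply: (implyP (between v)); rewrite vp (le_trans qu) // ltW.
  by rewrite (block_eq uB) (block_eq vB) eqxx in neq.
have qp_arc : pipe_arc (block q) (block p).
  rewrite /pipe_arc /= !pipe_QQ // block_disjoint 1?eq_sym //=.
  apply/exists_inP; exists q; first exact: mem_block.
  by apply/exists_inP; exists p; first exact: mem_block.
move: pq => /connectP[s ps sq]; case: QQ_piping => _ _ _ /(_ (block p :: s)).
suff [-> cyc] : all (mem QQ) (block p :: s) /\ cycle (@pipe_arc d P) (block p :: s).
  by move=> /(_ isT cyc).
split; last first.
  rewrite /= rcons_path -sq qp_arc andbT.
  by apply: sub_path ps => A B /and3P[].
rewrite /= pQ /= {sq}; elim: s (block p) ps => //= A s IHs B /andP[/and3P[_ -> _]].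
exact: IHs.
Qed.

Local Notation arc := (hasse_arc P).
Implicit Types a : arc.

Definition level_arcs : {set arc} :=
  [set a in arcs_in Q | block (arc_source a) != block (arc_target a)].

(** Levels exist since blocks are ordered: count the elements that lie weakly
    below a block. *)
Lemma level_heights : exists H : {set P} -> nat, forall a, a \in level_arcs ->
  [/\ (H (block (arc_source a)) < H (block (arc_target a)))%N,
      (H (block (arc_target a)) <= #|level_arcs|)%N &
      (1 < #|level_arcs|)%N ->
      ((H (block (arc_target a)) - H (block (arc_source a))).*2 <=
       \sum_(c in level_arcs) (H (block (arc_target c)) - H (block (arc_source c))))%N].
Proof.
pose f C := #|[set w | [exists u in C, connect preceq w u]]|.
apply: (balanced_heights (f := f)) => a; rewrite inE arcs_inE => /andP[aQ neq].
set s := arc_source a in neq *; set t := arc_target a in neq *.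
have sQ : s \in Q by apply: (subsetP aQ); apply: mem_source.
have tQ : t \in Q by apply: (subsetP aQ); apply: mem_target.
have to_s u : u \in block s -> connect preceq u s.
  move=> us; apply: connect1; rewrite /preceq sQ (block_eq us) eqxx orbT !andbT.
  case: (block_cases s) => [sE|/subpipe_sub/subsetP/(_ u us) //].
  by move: us; rewrite sE => /set1P->.
apply: proper_card; apply/properP; split.
  apply/subsetP => w; rewrite !inE => /exists_inP[u us wu]; apply/exists_inP.
  exists t; first exact: mem_block.
  apply: connect_trans wu (connect_trans (to_s u us) _); apply: connect1.
  by rewrite /preceq sQ tQ ltW // arc_lt.
exists t; first by rewrite inE; apply/exists_inP; exists t; rewrite ?mem_block.
rewrite inE; apply/negP => /exists_inP[u us tu].
have /negP := preceq_acyclic sQ tQ (arc_lt a) neq; apply.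
exact: connect_trans tu (to_s u us).
Qed.

End QuotientClasses.

(** * Every piping is realized by heights *)

Lemma norm_sub_le (R : realDomainType) (x y c : R) :
  0 <= x <= c -> 0 <= y <= c -> `|x - y| <= c.
Proof. by move=> /andP[x0 xc] /andP[y0 yc]; rewrite ler_norml; lra. Qed.

Lemma gap_lt (R : realDomainType) (t u r q i mi md : R) :
  t + u + r <= q + i -> 0 < r -> i <= mi -> mi + md <= u -> t < q - md.
Proof. by lra. Qed.

Lemma sum_gt (R : realDomainType) (t p u v : R) :
  t + 1 <= p -> p <= u -> 0 <= v -> t < u + v.
Proof. by lra. Qed.

Section Realization.
Context {d : Order.disp_t} {P : finPOrderType d} (R : realType).
Local Notation arc := (hasse_arc P).
Local Notation b := #|tubes P|.
Local Notation z := (inner_weight (tubes P) (@rho d R P)).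
Hypotheses (cardP : (1 < #|P|)%N)
  (connP : induces_connected (@hasse_adj d P) [set: P]).
Context (QQ : {set {set P}}).
Hypothesis QQ_piping : piping QQ.
Implicit Types (a : arc) (T X : {set arc}) (Q C : {set P}) (p q r v : P) (h g : P -> R).

Lemma rho0 T : T \in tubes P -> 0 <= rho R T.
Proof. exact: rho_ge0. Qed.

(** The heights h make exactly the tubes of pipes of QQ tight, among the tubes
    inside Q. *)
Definition realizes h Q : Prop :=
  (forall C, C \in QQ -> C \subset Q ->
     mass (increment h) (arcs_in C) = z (arcs_in C)) /\
  (forall T, T \in tubes P -> T \subset arcs_in Q ->
     (forall C, C \in QQ -> T != arcs_in C) -> z T < mass (increment h) T).

Lemma realizes_ge h Q X :
  realizes h Q -> X \subset arcs_in Q -> z X <= mass (increment h) X.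
Proof.
move=> [tight strict]; apply: (inner_weight_le_mass (@line_sym d P)) => // T TB TQ.
case: (boolP [exists C in QQ, T == arcs_in C]) => [/exists_inP[C CQQ /eqP TE]|no].
  rewrite TE tight // -(pipe_vertices (pipe_QQ QQ_piping CQQ)) -TE.
  exact: fintype.subset_trans (vertices_sub TQ) (vertices_arcs_in _).
apply/ltW/strict => // C CQQ; apply: contraNneq no => TE.
by apply/exists_inP; exists C; rewrite ?TE.
Qed.

Lemma increment_shift h (c : R) : increment (fun v => h v - c) =1 increment h.
Proof. by move=> a; rewrite /increment; lra. Qed.

Lemma eq_mass (x y : arc -> R) X :
  (forall a, a \in X -> x a = y a) -> mass x X = mass y X.
Proof. by move=> xy; apply: eq_bigr. Qed.

(** Heights matter up to a constant only, so the least one may be taken to be 0. *)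
Lemma realizes_normalized h Q : Q \in QQ -> realizes h Q ->
  exists2 g, realizes g Q & forall v, v \in Q -> 0 <= g v <= z (arcs_in Q).
Proof.
move=> QQQ hQ; have pQ := pipe_QQ QQ_piping QQQ.
have [v0 v0Q] : exists v, v \in Q.
  by have /and3P[cQ _ _] := pQ; apply/card_gt0P; apply: ltnW.
case: (@arg_minP _ _ _ v0 (mem Q) h v0Q) => m mQ m_min.
have mE X : mass (increment (fun v => h v - h m)) X = mass (increment h) X.
  by apply: eq_mass => a _; apply: increment_shift.
exists (fun v => h v - h m).
  have [tight strict] := hQ; split=> [C CQQ CQ|T TB TQ noC]; rewrite mE; first exact: tight.
  exact: strict.
move=> v vQ; rewrite subr_ge0 m_min //=.
have [tight _] := hQ; rewrite -tight //; apply: spread_le_mass.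
  move=> a aQ; rewrite -(mass1 (increment h)).
  apply: le_trans (realizes_ge hQ _); last by rewrite sub1set.
  exact: inner_weight_ge0.
by apply: tube_joined; rewrite ?pipe_vertices //; apply: pipe_tube.
Qed.

Section Step.
Context (Q : {set P}) (QQQ : Q \in QQ).
Local Notation subpipes := (subpipes QQ Q).
Local Notation block := (block QQ Q).
Local Notation level_arcs := (level_arcs QQ Q).
Context (g : {set P} -> P -> R).
Hypotheses (g_realizes : forall C, C \in subpipes -> realizes (g C) C)
  (g_bound : forall C, C \in subpipes -> forall v, v \in C -> 0 <= g C v <= z (arcs_in C)).

Definition inner_arcs : {set arc} := arcs_in Q :\: level_arcs.

(** The heights inside the blocks, before the levels of the blocks are added. *)
Definition offset v : R := if block v \in subpipes then g (block v) v else 0.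

Lemma arcs_in_inner C : C \in subpipes -> arcs_in C \subset inner_arcs.
Proof.
move=> CD; apply/subsetP => a aC.
rewrite inE (subsetP (arcs_in_sub (subpipe_sub CD)) _ aC) andbT inE negb_and negbK.
apply/orP; right; apply/eqP; move: aC; rewrite inE => /andP[sC tC].
exact: (block_subpipe_eq QQ_piping CD tC).
Qed.

Lemma inner_arcsP a : a \in inner_arcs ->
  block (arc_source a) \in subpipes /\ a \in arcs_in (block (arc_source a)).
Proof.
rewrite inE [in X in ~~ X]inE => /andP[+ aQ]; rewrite aQ negbK => /eqP same.
have neq : arc_source a != arc_target a by rewrite lt_eqF // arc_lt.
split; first exact: (block_neq_subpipe QQ_piping same neq).
by rewrite inE mem_block same mem_block.
Qed.

Lemma offset_block C a : C \in subpipes -> a \in arcs_in C ->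
  increment offset a = increment (g (block (arc_source a))) a.
Proof.
move=> CD; rewrite inE => /andP[sC tC]; rewrite /increment /offset.
have bE := block_subpipe_eq QQ_piping CD sC tC.
by rewrite bE (block_subpipe QQ_piping CD sC).
Qed.

Lemma offset_mass X v : block v \in subpipes -> X \subset arcs_in (block v) ->
  mass (increment offset) X = mass (increment (g (block v))) X.
Proof.
move=> vD Xv; apply: eq_mass => a aX; have av := subsetP Xv a aX.
rewrite (offset_block vD av); congr (increment (g _) a).
by apply: (block_eq QQ_piping); move: av; rewrite inE => /andP[].
Qed.

(** Adjacent inner arcs share an endpoint and hence the block, so connectedness
    spreads the block of one arc over the tube. *)
Lemma inner_tube T : T \in tubes P -> T \subset inner_arcs ->
  exists v, block v \in subpipes /\ T \subset arcs_in (block v).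
Proof.
move=> TB TU; have /connected_setsP[/set0Pn[a0 a0T] conT] := TB.
have [vD a0v] := inner_arcsP (subsetP TU a0 a0T).
set v := arc_source a0 in vD a0v; exists v; split=> //; apply/subsetP.
apply: (connected_ind conT a0T a0v) => a c aT cT ac av.
have [wD cw] := inner_arcsP (subsetP TU c cT); have [u ua uc] := line_graph_common ac.
suff <- : block (arc_source c) = block v by [].
rewrite -(block_eq QQ_piping (u := u) (v := v)).
  by rewrite -(block_eq QQ_piping (u := u) (v := arc_source c)) //;
    move: cw; rewrite arcs_inE => /subsetP; apply.
by move: av; rewrite arcs_inE => /subsetP; apply.
Qed.

Lemma offset_ge X : X \subset inner_arcs -> z X <= mass (increment offset) X.
Proof.
apply: (inner_weight_le_mass (@line_sym d P)) => // T TB TU; have [v [vD Tv]] := inner_tube TB TU.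
by rewrite (offset_mass vD Tv); apply: realizes_ge Tv; apply: g_realizes.
Qed.

(** Removing one block at a time: each is tight, and z is superadditive. *)
Lemma offset_saturated X : X \subset inner_arcs ->
  (forall a c, a \in X -> c \in inner_arcs ->
     block (arc_source a) = block (arc_source c) -> c \in X) ->
  mass (increment offset) X <= z X.
Proof.
move: {2}_.+1 (ltnSn #|X|) => n; elim: n X => // n IHn X; rewrite ltnS => cX XU satX.
have [->|/set0Pn[a aX]] := eqVneq X set0; first by rewrite mass0 inner_weight_ge0.
have [vD av] := inner_arcsP (subsetP XU a aX); set v := arc_source a in vD av.
have in_block c : c \in arcs_in (block v) -> block (arc_source c) = block v.
  by rewrite inE => /andP[sv _]; apply: (block_eq QQ_piping).
have vX : arcs_in (block v) \subset X.
  apply/subsetP => c cv; apply: (satX a) => //; last by rewrite (in_block c cv).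
  exact: (subsetP (arcs_in_inner vD)).
have IH : mass (increment offset) (X :\: arcs_in (block v)) <= z (X :\: arcs_in (block v)).
  apply: IHn; last 2 first.
  - exact: fintype.subset_trans (subsetDl _ _) XU.
  - move=> c e /setDP[cX' cv] eU ce; rewrite inE (satX c e) // andbT.
    apply: contra cv => ev; have [_] := inner_arcsP (subsetP XU c cX').
    by rewrite ce (in_block e ev).
  apply: leq_trans cX; apply: proper_card; apply/properP; split; first exact: subsetDl.
  by exists a => //; rewrite inE av.
rewrite (mass_setID _ X (arcs_in (block v))) (finset.setIidPr vX).
rewrite (offset_mass vD (subxx _)).
have [tight _] := g_realizes vD; have /subpipesP[vQQ _] := vD.
rewrite tight //; apply: le_trans (lerD (lexx _) IH) _.
have := inner_weight_supermodular rho0 (arcs_in (block v)) (X :\: arcs_in (block v)).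
have -> : arcs_in (block v) :&: (X :\: arcs_in (block v)) = set0.
  by apply/setP => c; rewrite in_setI in_setD in_set0; case: (c \in arcs_in _).
have -> : arcs_in (block v) :|: (X :\: arcs_in (block v)) = X.
  by rewrite -{1}(finset.setIidPr vX) finset.setID.
by rewrite inner_weight0 ?connected_sets0 // addr0.
Qed.

Lemma offset_total : mass (increment offset) inner_arcs <= z inner_arcs.
Proof. exact: offset_saturated. Qed.

Lemma offset_bound v : 0 <= offset v <= z inner_arcs.
Proof.
rewrite /offset; case: ifP => [vD|_]; last by rewrite lexx inner_weight_ge0.
have /andP[-> /le_trans->] // := g_bound vD (mem_block QQ Q v).
by apply: le_inner_weight => //; apply: arcs_in_inner.
Qed.

Lemma level_sub : level_arcs \subset arcs_in Q.
Proof. by apply/subsetP => a; rewrite inE => /andP[]. Qed.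

Lemma Q_tube : arcs_in Q \in tubes P.
Proof. exact: pipe_tube (pipe_QQ QQ_piping QQQ). Qed.

Lemma Q_not_inner : ~~ (arcs_in Q \subset inner_arcs).
Proof.
apply/negP => /(inner_tube Q_tube)[v [/subpipesP[_ /properP[_ [u uQ uv]]] Qv]].
have := subsetP (vertices_sub Qv) u; rewrite pipe_vertices ?(pipe_QQ QQ_piping) //.
by move=> /(_ uQ)/(subsetP (vertices_arcs_in _)); rewrite (negPf uv).
Qed.

Lemma level_gt0 : (0 < #|level_arcs|)%N.
Proof.
have /subsetPn[a aQ] := Q_not_inner; rewrite inE aQ andbT negbK => aE.
by apply/card_gt0P; exists a.
Qed.

(** The factor delta of the levels is determined by the condition that Q be tight.
    On arcs inside the blocks the levels cancel, so all tubes without level arcs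
    behave as in their block. *)
Lemma realizes_step : exists h, realizes h Q.
Proof.
have [H HP] := level_heights QQ_piping Q.
pose len a := (H (block (arc_target a)) - H (block (arc_source a)))%N.
pose L := (\sum_(a in level_arcs) len a)%N.
have L0 : 0 < L%:R :> R.
  rewrite ltr0n; apply: leq_trans level_gt0 _; rewrite -sum1_card.
  by apply: leq_sum => a /HP[Hlt _ _]; rewrite subn_gt0.
pose delta := (z (arcs_in Q) - mass (increment offset) (arcs_in Q)) / L%:R.
pose h v := delta * (H (block v))%:R + offset v.
have h_level a : a \in level_arcs -> increment h a = delta * (len a)%:R + increment offset a.
  by move=> /HP[Hlt _ _]; rewrite /increment /h natrB ?(ltnW Hlt) //; lra.
have h_inner a : a \in inner_arcs -> increment h a = increment offset a.
  move=> /inner_arcsP[vD]; rewrite inE => /andP[_ tv].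
  by rewrite /increment /h (block_eq QQ_piping tv); lra.
have mass_inner X : X \subset inner_arcs -> mass (increment h) X = mass (increment offset) X.
  by move=> XU; apply: eq_mass => a /(subsetP XU)/h_inner.
have splitQ (x : arc -> R) : mass x (arcs_in Q) = mass x level_arcs + mass x inner_arcs.
  by rewrite (mass_setID x _ level_arcs) (finset.setIidPr level_sub).
have total_level : mass (increment h) level_arcs =
    delta * L%:R + mass (increment offset) level_arcs.
  by rewrite /L natr_sum mulr_sumr -big_split; apply: eq_bigr.
have totalQ : mass (increment h) (arcs_in Q) = z (arcs_in Q).
  rewrite splitQ total_level mass_inner // divfK ?gt_eqF //.
  by rewrite splitQ; lra.
have inner_sub : inner_arcs \subset arcs_in Q by apply: subsetDl.
have cardQ : (#|arcs_in Q| = #|level_arcs| + #|inner_arcs|)%N.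
  by rewrite -(cardsID level_arcs) (finset.setIidPr level_sub).
have level_total : (b ^ #|arcs_in Q|)%N%:R <= mass (increment h) level_arcs.
  have gain := inner_weight_gain rho0 Q_tube inner_sub (subxx _) Q_not_inner.
  rewrite -[leLHS]/(rho R (arcs_in Q)).
  have -> : mass (increment h) level_arcs =
      z (arcs_in Q) - mass (increment offset) inner_arcs.
    by rewrite -totalQ splitQ (mass_inner _ (subxx _)) addrK.
  rewrite lerBrDr; apply: le_trans gain; rewrite [leLHS]addrC lerD2r.
  exact: offset_total.
have count : (#|arcs_in Q|.*2 <= b.+1)%N.
  apply: leq_trans (tubes_count cardP connP); rewrite leq_double.
  exact: max_card.
exists h; split=> [C CQQ CQ|T TB TQ noC].
  have [->//|CneqQ] := eqVneq C Q.
  have CD : C \in subpipes.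
    by rewrite inE CQQ properEneq CneqQ.
  have /set0Pn[v vC] : C != set0.
    have /and3P[cC _ _] := pipe_QQ QQ_piping CQQ.
    by rewrite -card_gt0; apply: ltnW.
  have vD := block_subpipe QQ_piping CD vC; have Cv := sub_block CD vC.
  rewrite mass_inner ?arcs_in_inner // (offset_mass vD) ?arcs_in_sub //.
  by have [tight _] := g_realizes vD; apply: tight.
case: (boolP (T \subset inner_arcs)) => [TU|TU].
  have [v [vD Tv]] := inner_tube TB TU.
  rewrite mass_inner // (offset_mass vD) //.
  by have [_ strict] := g_realizes vD; apply: strict.
(* A tube with all level arcs is Q with inner arcs X removed. These carry at
   most the weight of the inner tubes meeting X, less than that of all tubes
   meeting X, as Q is one of them. *)
case: (boolP (level_arcs \subset T)) => [ET|ET].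
  have missU : arcs_in Q :\: T \subset inner_arcs.
    by apply: setDS.
  have : mass (increment h) T = z (arcs_in Q) - mass (increment h) (arcs_in Q :\: T).
    by rewrite -totalQ (mass_setID _ (arcs_in Q) T) (finset.setIidPr TQ) addrK.
  rewrite (mass_inner _ missU) => ->.
  have QT : ~~ (arcs_in Q \subset T).
    by apply: contra (noC Q QQQ) => QT; rewrite finset.eqEsubset TQ.
  have QE : T :|: inner_arcs = arcs_in Q.
    apply/eqP; rewrite finset.eqEsubset subUset TQ inner_sub /=.
    apply/subsetP => a aQ; rewrite inE; case: (boolP (a \in T)) => //= aT.
    by apply: (subsetP missU); rewrite inE aT.
  have := inner_weight_supermodular_strict rho0 Q_tube _ QT Q_not_inner.
  rewrite QE => /(_ (subxx _)) super.
  have missE : inner_arcs :\: T = arcs_in Q :\: T.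
    apply/setP => a; rewrite !in_setD; case: (boolP (a \in T)) => //= aT.
    by rewrite (contra (subsetP ET a) aT).
  have := offset_total.
  rewrite (mass_setID _ inner_arcs T) missE [inner_arcs :&: T]finset.setIC.
  apply: gap_lt super _ (offset_ge (subsetIr T inner_arcs)).
  exact: (rho_gt0 R cardP connP Q_tube).
(* Some level arcs are missing: the tube is small compared to Q, and its level
   arcs alone carry enough. *)
have TE0 : T :&: level_arcs != set0.
  apply: contraNneq TU => TE0; apply/subsetP => a aT.
  rewrite inE (subsetP TQ a aT) andbT; apply/negP => aE.
  by have := in_set0 a; rewrite -TE0 inE aT aE.
have TEp : T :&: level_arcs \proper level_arcs.
  by rewrite properE subsetIr subsetI subxx andbT.
have zeta_le : z inner_arcs + 1 <= ((1 + b) ^ (#|arcs_in Q| - #|level_arcs|))%N%:R.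
  by rewrite cardQ addKn; apply: inner_weight_lt.
have off_le a : a \in level_arcs -> `|increment offset a| <= z inner_arcs.
  by move=> _; apply: norm_sub_le; apply: offset_bound.
have En : (#|level_arcs| <= #|arcs_in Q|)%N by rewrite cardQ leq_addr.
have := level_sum_ge h_level off_le _ _ _ level_total zeta_le En count TEp TE0.
rewrite (_ : level_arcs :\: _ = level_arcs :\: T); last first.
  by apply/setP => a; rewrite !in_setD in_setI; case: (a \in T); case: (a \in level_arcs).
have -> : mass (increment h) T = mass (increment h) (T :&: level_arcs) +
    mass (increment h) (T :\: level_arcs) by apply: mass_setID.
have TDU : T :\: level_arcs \subset inner_arcs by apply: setSD.
have : 0 <= mass (increment h) (T :\: level_arcs).
  by rewrite mass_inner //; apply: le_trans (offset_ge TDU); apply: inner_weight_ge0.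
have : z T + 1 <= ((1 + b) ^ (#|arcs_in Q| - #|level_arcs :\: T|))%N%:R.
  apply: le_trans (inner_weight_lt R T) _; rewrite ler_nat leq_pexp2l //.
  rewrite leq_subRL; last first.
    by apply: subset_leq_card; apply: fintype.subset_trans (subsetDl _ _) level_sub.
  rewrite addnC -cardsUI [_ :&: _](_ : _ = set0) ?cards0 ?addn0; last first.
    by apply/setP => a; rewrite in_setI in_setD in_set0; case: (a \in T); rewrite ?andbF.
  apply: subset_leq_card; rewrite subUset TQ.
  exact: fintype.subset_trans (subsetDl _ _) level_sub.
move=> zT h0 lev; apply: (sum_gt zT _ h0).
apply: lev => a aE; have [Hlt Hle Hhalf] := HP a aE.
- by rewrite subn_gt0.
- by apply: leq_trans (leq_subr _ _) Hle.
- exact: Hhalf.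
Qed.

End Step.

(** Apply the construction to the smaller pipes first. *)
Lemma realizable Q : Q \in QQ -> exists h, realizes h Q.
Proof.
move: {2}_.+1 (ltnSn #|Q|) => n; elim: n Q => // n IHn Q; rewrite ltnS => cQ QQQ.
have ex C : exists g, C \in subpipes QQ Q ->
    realizes g C /\ forall v, v \in C -> 0 <= g v <= z (arcs_in C).
  case: (boolP (C \in subpipes QQ Q)) => [/subpipesP[CQQ CQ]|_]; last by exists (fun=> 0).
  have [h hC] := IHn C (leq_trans (proper_card CQ) cQ) CQQ.
  by have [g gC g0] := realizes_normalized CQQ hC; exists g.
have /choice[g gP] := ex.
by apply: (realizes_step QQQ (g := g)) => C CD; have [] := gP C CD.
Qed.

End Realization.

(** * Faces of the acyclonestohedron *)

Section Faces.
Context {d : Order.disp_t} {P : finPOrderType d} (R : realType).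
Local Notation arc := (hasse_arc P).
Local Notation V := {ffun arc -> R^o}.
Local Notation z := (inner_weight (tubes P) (@rho d R P)).
Local Notation A := (acyclonestohedron R P).
Hypotheses (cardP : (1 < #|P|)%N)
  (connP : induces_connected (@hasse_adj d P) [set: P]).
Implicit Types (x y : V) (T X : {set arc}) (Q : {set P}) (N QQ : {set {set P}}).

Lemma acyclonestohedronP x :
  A x <-> [/\ exists h, forall a, x a = increment h a :> R,
              mass x setT = z setT & forall X, z X <= mass x X].
Proof.
have P0 : (0 < #|P|)%N by apply: ltnW.
have hP := nestohedronP x (fun T TB => rho_gt0 R cardP connP TB) (connected_sets0 _).
split=> [[/hP[xT xX] /(circuits_increment x connP P0)] //|[xh xT xX]].
by split; [apply/hP | apply/(circuits_increment x connP P0)].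
Qed.

Definition tight_face N : classical_sets.set V :=
  [set x | A x /\ forall Q, Q \in N -> mass x (arcs_in Q) = z (arcs_in Q)]%classic.

(** An affine combination, with s not restricted to [0, 1]: s = 1 + eps moves
    from x slightly away from y. *)
Definition blend (s : R) x y : V := [ffun a => (s * x a + (1 - s) * y a : R) : R^o].

Lemma mass_blend s x y X :
  mass (blend s x y) X = s * mass x X + (1 - s) * mass y X.
Proof.
by rewrite /mass !mulr_sumr -big_split; apply: eq_bigr => a _; rewrite ffunE.
Qed.

Lemma dot_blend u s x y : dot u (blend s x y) = s * dot u x + (1 - s) * dot u y.
Proof.
rewrite /dot !mulr_sumr -big_split; apply: eq_bigr => a _; rewrite ffunE /=.
by rewrite mulrDr !mulrA ![u a * _]mulrC.
Qed.

Lemma blend_mem s x y : A x -> A y ->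
  (forall T, T \in tubes P -> z T <= s * mass x T + (1 - s) * mass y T) ->
  A (blend s x y).
Proof.
move=> /acyclonestohedronP[[h xh] xT _] /acyclonestohedronP[[g yg] yT _] sT.
apply/acyclonestohedronP; split.
- exists (fun v => s * h v + (1 - s) * g v) => a.
  by rewrite ffunE xh yg /increment; lra.
- by rewrite mass_blend xT yT; lra.
- move=> X; apply: (inner_weight_le_mass (@line_sym d P) (A := setT)) => //.
  by move=> T TB _; rewrite mass_blend; apply: sT.
Qed.

Lemma piping_point QQ : piping QQ -> exists x, [/\ A x,
  forall Q, Q \in QQ -> mass x (arcs_in Q) = z (arcs_in Q) &
  forall Q, pipe Q -> mass x (arcs_in Q) = z (arcs_in Q) -> Q \in QQ].
Proof.
move=> pQQ; have PQQ : [set: P] \in QQ by case: pQQ.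
have [h hP] := realizable R cardP connP pQQ PQQ; have [tight strict] := hP.
pose x : V := [ffun a => (increment h a : R) : R^o].
have xE X : mass x X = mass (increment h) X by apply: eq_mass => a _; rewrite ffunE.
exists x; split=> [|Q QQQ|Q pQ].
- apply/acyclonestohedronP; split=> [||X]; rewrite ?xE.
  + by exists h => a; rewrite ffunE.
  + by rewrite -arcs_in_setT tight.
  + by apply: (realizes_ge pQQ hP); rewrite arcs_in_setT finset.subsetT.
- by rewrite xE tight // finset.subsetT.
- rewrite xE => tQ; apply: contraT => QQ'.
  have := strict _ (pipe_tube pQ); rewrite arcs_in_setT finset.subsetT tQ ltxx.
  move=> /(_ isT) no; suff // : false by [].
  apply: no => C CQQ; apply: contraNneq QQ' => QC.
  by rewrite -(pipe_vertices pQ) QC pipe_vertices // (pipe_QQ pQQ).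
Qed.

Lemma point_piping x : A x -> exists QQ, [/\ piping QQ,
  forall Q, Q \in QQ -> mass x (arcs_in Q) = z (arcs_in Q) &
  forall T, T \in tubes P -> mass x T = z T -> exists2 Q, Q \in QQ & T = arcs_in Q].
Proof.
move=> /acyclonestohedronP[[h xh] xT xX].
have xE X : mass x X = mass (increment h) X by apply: eq_mass => a _; rewrite xh.
have h_ge X : z X <= mass (increment h) X by rewrite -xE.
exists (tight_pipes h); split.
- by apply: tight_pipes_piping => //; rewrite -xE.
- by move=> Q /tight_pipesP[_]; rewrite xE.
- by move=> T TB; rewrite xE => Tt; apply: tight_tube_pipe.
Qed.

(** The face is exposed by minus the sum of the indicators of its tight pipes; the
    point realizing the piping attains the maximum. *)
Lemma tight_face_nonempty_face QQ :
  piping QQ -> nonempty_face A (tight_face (QQ :\ [set: P])).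
Proof.
move=> /piping_point[p [Ap tight _]]; set N := QQ :\ _.
have pN Q : Q \in N -> mass p (arcs_in Q) = z (arcs_in Q) by move=> /setD1P[_ /tight].
split; first by exists p.
pose u : V := [ffun a => (- \sum_(Q in N) (a \in arcs_in Q)%:R : R) : R^o].
have uE y : dot u y = - \sum_(Q in N) mass y (arcs_in Q).
  rewrite /dot -sumrN (eq_bigr (fun a => \sum_(Q in N) - ((a \in arcs_in Q)%:R * (y a : R)))).
    rewrite exchange_big /=; apply: eq_bigr => Q _; rewrite sumrN; congr (- _).
    rewrite /mass [RHS]big_mkcond; apply: eq_bigr => a _.
    by case: (_ \in _); rewrite ?mul1r ?mul0r.
  by move=> a _; rewrite ffunE sumrN mulNr mulr_suml.
exists u; apply/seteqP; split=> y.
  move=> [Ay yN]; split=> // w Aw; rewrite !uE lerN2; apply: ler_sum => Q QN.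
  by rewrite yN //; have /acyclonestohedronP[_ _] := Aw; apply.
move=> [Ay ymax]; split=> // Q QN.
have y_ge C : 0 <= mass y (arcs_in C) - z (arcs_in C).
  by rewrite subr_ge0; have /acyclonestohedronP[_ _] := Ay; apply.
apply/eqP; rewrite -subr_eq0; apply/eqP.
have : \sum_(C in N) (mass y (arcs_in C) - z (arcs_in C)) = 0.
  apply/eqP; rewrite eq_le sumr_ge0 // andbT sumrB subr_le0.
  have := ymax p Ap; rewrite !uE lerN2 => /le_trans; apply.
  by apply: ler_sum => C /pN->.
by move/eqP; rewrite psumr_eq0 // => /allP/(_ Q); rewrite mem_index_enum QN => /(_ isT)/eqP.
Qed.

(** The point that realizes QQ' lies in the smaller face, and no pipe outside QQ'
    is tight there. *)
Lemma tight_face_reverse QQ QQ' : piping QQ -> piping QQ' ->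
  (tight_face (QQ' :\ [set: P]%SET) `<=` tight_face (QQ :\ [set: P]%SET))%classic ->
  QQ :\ [set: P] \subset QQ' :\ [set: P].
Proof.
move=> pQQ /piping_point[p [Ap tight only]] sub.
have /sub[_ pN] : tight_face (QQ' :\ [set: P]) p by split=> // Q /setD1P[_ /tight].
apply/subsetP => Q QN; have /setD1P[QP QQQ] := QN.
by rewrite !inE QP /= only // ?pN // (pipe_QQ pQQ).
Qed.

Lemma small_step (I : finType) (B : {set I}) (f c : I -> R) :
  (forall i, i \in B -> 0 < f i) ->
  exists2 eps, 0 < eps & forall i, i \in B -> eps * c i <= f i.
Proof.
(* 1 / M works since M exceeds each of the ratios. *)
move=> f0; pose M := 1 + \sum_(i in B) `|c i| / f i.
have terms0 i : i \in B -> 0 <= `|c i| / f i.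
  by move=> iB; rewrite divr_ge0 // ltW // f0.
have M0 : 0 < M by rewrite ltr_pwDl // sumr_ge0.
exists M^-1 => [|i iB]; first by rewrite invr_gt0.
rewrite mulrC ler_pdivrMr // -ler_pdivrMl ?f0 // mulrC.
apply: le_trans (_ : `|c i| / f i <= _).
  by rewrite ler_pM2r ?invr_gt0 ?f0 // ler_norm.
rewrite /M (big_setD1 i iB) /= addrCA lerDl addr_ge0 //.
by apply: sumr_ge0 => j /setD1P[_ /terms0].
Qed.

Definition tight_tubes x : {set {set arc}} := [set T in tubes P | mass x T == z T].

(** Choose x in the face with as few tight tubes as possible. The midpoint of x
    and another point y of the face is tight only where both are, so y is tight
    wherever x is. Conversely, if y is tight wherever x is, one can move from x
    slightly away from y without leaving the polytope; as u is maximal at x, it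
    is maximal at y too. *)
Lemma nonempty_face_tight F : nonempty_face A F ->
  exists2 x, A x & forall y, F y <-> A y /\ tight_tubes x \subset tight_tubes y.
Proof.
move=> [[x0 Fx0] [u FE]].
pose tight_count n := `[< exists2 x, F x & #|tight_tubes x| = n >].
have ex_count : exists n, tight_count n.
  by exists #|tight_tubes x0|; apply/asboolP; exists x0.
case: (ex_minnP ex_count) => n /asboolP[x Fx xn] n_min.
have [Ax xmax] : A x /\ forall y, A y -> dot u y <= dot u x by move: Fx; rewrite FE.
exists x => // y; split=> [Fy|[Ay xy]].
  have [Ay ymax] : A y /\ forall w, A w -> dot u w <= dot u y by move: Fy; rewrite FE.
  split=> //; have /acyclonestohedronP[_ _ x_ge] := Ax.
  have /acyclonestohedronP[_ _ y_ge] := Ay.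
  pose m := blend (1 / 2) x y.
  have Am : A m by apply: blend_mem => // T _; have := x_ge T; have := y_ge T; move: (z T) (mass x T) (mass y T) => zT xT yT; lra.
  have Fm : F m.
    by rewrite FE; split=> // w Aw; rewrite dot_blend; have := xmax w Aw; have := ymax w Aw; lra.
  have m_sub : tight_tubes m \subset tight_tubes x :&: tight_tubes y.
    apply/subsetP => T; rewrite !inE => /andP[-> /eqP]; rewrite mass_blend.
    have := x_ge T; have := y_ge T; move: (z T) (mass x T) (mass y T) => zT xT yT.
    by move=> yz xz mz; apply/andP; split; apply/eqP; lra.
  have x_count : (#|tight_tubes x| <= #|tight_tubes x :&: tight_tubes y|)%N.
    apply: leq_trans (subset_leq_card m_sub); rewrite xn; apply: n_min.
    by apply/asboolP; exists m.
  apply/finset.setIidPl/eqP; rewrite eqEcard x_count andbT; exact: subsetIl.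
have /acyclonestohedronP[_ _ x_ge] := Ax.
have slack T : T \in tubes P :\: tight_tubes x -> 0 < mass x T - z T.
  rewrite inE => /andP[+ TB]; rewrite inE TB /= => neq.
  by rewrite subr_gt0 lt_neqAle eq_sym neq x_ge.
have [eps eps0 eps_le] := small_step (fun T => mass y T - mass x T) slack.
have Aw : A (blend (1 + eps) x y).
  apply: blend_mem => // T TB; case: (boolP (T \in tight_tubes x)) => Tt.
    have := subsetP xy T Tt; move: Tt; rewrite !inE => /andP[_ /eqP->] /andP[_ /eqP->].
    by rewrite -mulrDl addrCA subrr addr0 mul1r.
  have := eps_le T; rewrite inE Tt TB => /(_ isT).
  by move: (z T) (mass x T) (mass y T) => zT xT yT; lra.
rewrite FE; split=> // w Aw'; apply: le_trans (xmax w Aw') _.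
have := xmax _ Aw; rewrite dot_blend => le_x.
by rewrite -(ler_pM2l eps0); lra.
Qed.

Lemma nonempty_face_piping F : nonempty_face A F ->
  exists2 QQ, piping QQ & tight_face (QQ :\ [set: P]) = F.
Proof.
move=> /nonempty_face_tight[x Ax FP].
have [QQ [pQQ tight only]] := point_piping Ax; exists QQ => //.
apply/seteqP; split=> y.
  move=> [Ay yN]; apply/FP; split=> //; apply/subsetP => T.
  rewrite inE => /andP[TB /eqP Tt]; rewrite inE TB /=; apply/eqP.
  have [Q QQQ ->] := only T TB Tt.
  have [->|QP] := eqVneq Q [set: P]; last by apply: yN; rewrite !inE QP.
  by rewrite arcs_in_setT; have /acyclonestohedronP[_ ->] := Ay.
move=> /FP[Ay xy]; split=> // Q /setD1P[_ QQQ].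
have TB := pipe_tube (pipe_QQ pQQ QQQ).
have : arcs_in Q \in tight_tubes x by rewrite inE TB tight ?eqxx.
by move=> /(subsetP xy); rewrite inE => /andP[_ /eqP].
Qed.

End Faces.

Theorem corollary10p9 (R : realType) (d : Order.disp_t) (P : finPOrderType d)
    (cardP : (1 < #|P|)%N)
    (connP : induces_connected (@hasse_adj d P) [set: P]%SET) :
  isomorphic_to_polar_boundary (piping_complex P) (acyclonestohedron R P).
Proof.
exists (@tight_face d P R); split; last first.
  move=> _ _ [QQ pQQ ->] [QQ' pQQ' ->]; split; last exact: tight_face_reverse.
  by move=> /subsetP sub x [Ax xN]; split=> // Q /sub/xN.
split=> [_ [QQ pQQ ->]|_ _ /set_mem[QQ pQQ ->] /set_mem[QQ' pQQ' ->] eqF|F faceF].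
- exact: tight_face_nonempty_face.
- by apply/eqP; rewrite finset.eqEsubset !(tight_face_reverse (R := R) cardP connP) // eqF.
- have [QQ pQQ <-] := nonempty_face_piping cardP connP faceF.
  by exists (QQ :\ [set: P]) => //; exists QQ.
Qed.
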